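(* For all integers $t\ge 6$ and $n\ge 3t-6$, $2n+3t-15\le ar_{\mathcal{P}}(n, M_t)\le 2n+4t-14$.
   Context: All graphs are finite and simple. For $t\ge1$, $M_t$ denotes a matching with $t$ edges (i.e., $t$ pairwise disjoint edges). A subgraph of an edge-colored graph is rainbow if all of its edges have distinct colors. For a planar graph $H$ and an integer $n\ge |H|$, let $\mathcal{T}_n(H)$ be the family of all plane triangulations on $n$ vertices that contain a subgraph isomorphic to $H$. The planar anti-Ramsey number $ar_{\mathcal{P}}(n,H)$ is the maximum number of colors in an edge-coloring of a plane triangulation $T\in\mathcal{T}_n(H)$ such that $T$ contains no rainbow copy of $H$. *)

(* Defs.v *)
From mathcomp Require Import all_boot all_fingroup.

Set Implicit Arguments.
Unset Strict Implicit.
Unset Printing Implicit Defensive.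

(* A finite simple graph on the vertex type V is given by its edge set
   E : {set {set V}}, all of whose members have exactly two elements. *)
Section SimpleGraph.
Variable V : finType.
Implicit Types (E : {set {set V}}) (x y : V).

Definition simple E : bool := [forall e in E, #|e| == 2].

Definition adj E : rel V := fun x y => [set x; y] \in E.

Definition nbhd E x : {set V} := [set y | adj E x y].

Definition connected E : bool := [forall x, forall y, connect (adj E) x y].

Definition darts E : {set V * V} := [set d | adj E d.1 d.2].

End SimpleGraph.

(* Plane embeddings are represented combinatorially, by rotation systems: r x
   gives the cyclic order in which the neighbours of x appear around x. (The
   values of r x outside the neighbourhood of x are irrelevant.) *)
Section PlaneEmbedding.
Variable V : finType.
Implicit Types (E : {set {set V}}) (r : {ffun V -> {perm V}}).

Definition rotation_system E r : bool :=
  [forall x, forall y in nbhd E x, porbit (r x) y == nbhd E x].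

(* Face tracing: the boundary walk entering y along the dart (x, y) leaves y
   along the edge that follows {y, x} in the cyclic order around y. *)
Definition face_next r (d : V * V) : V * V := (d.2, r d.2 d.1).

Lemma face_next_inj r : injective (face_next r).
Proof. by case=> [x y] [x' y'] [<- /perm_inj ->]. Qed.

Definition face_perm r : {perm V * V} := perm (@face_next_inj r).

Definition faces E r : {set {set V * V}} :=
  [set porbit (face_perm r) d | d in darts E].

(* For a connected graph with at least one edge, the surface carrying the
   embedding is the sphere iff the Euler characteristic is 2. *)
Definition plane_embedding E r : bool :=
  [&& connected E, rotation_system E r & #|V| + #|faces E r| == #|E| + 2].

(* In a simple graph a closed face walk of length 3 is a triangle. The faces
   include the outer one. *)
Definition plane_triangulation E : bool :=
  simple E &&
  [exists r, plane_embedding E r && [forall f in faces E r, #|f| == 3]].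

End PlaneEmbedding.

Section AntiRamsey.
Variables (U : finType) (H : {set {set U}}).

(* phi is an isomorphism from H onto a subgraph of E. *)
Definition is_copy (V : finType) (E : {set {set V}}) (phi : {ffun U -> V}) :=
  injectiveb phi && [forall e in H, phi @: e \in E].

Definition contains_copy (V : finType) (E : {set {set V}}) : bool :=
  [exists phi : {ffun U -> V}, is_copy E phi].

Definition rainbow (V C : finType) (c : {ffun {set V} -> C})
    (phi : {ffun U -> V}) : bool :=
  [forall e in H, forall e' in H,
     (c (phi @: e) == c (phi @: e')) ==> (e == e')].

(* Some plane triangulation on n vertices containing H has an edge-coloring
   with exactly k colors and without rainbow copy of H. Only the values of the
   coloring on E matter. *)
Definition rainbow_free_colors (n k : nat) : bool :=
  [exists E : {set {set 'I_n}},
    [&& plane_triangulation E, contains_copy E &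
      [exists c : {ffun {set 'I_n} -> 'I_k},
        (c @: E == [set: 'I_k]) &&
        ~~ [exists phi : {ffun U -> 'I_n}, is_copy E phi && rainbow c phi]]]].

(* The bound 'C(n, 2) on the number of colors makes the maximum range over a
   finite set and loses nothing, see planar_ar_max. *)
Definition planar_ar (n : nat) : nat :=
  \max_(k < 'C(n, 2).+1 | rainbow_free_colors n k) k.

Lemma planar_ar_max n k : rainbow_free_colors n k -> k <= planar_ar n.
Proof.
move=> Hk; have ltk : k < 'C(n, 2).+1.
  case/existsP: Hk => E /and3P[/andP[/forall_inP sE _] _].
  case/existsP=> c /andP[/eqP cE _].
  rewrite ltnS -(card_ord k) -cardsT -cE.
  apply: leq_trans (leq_imset_card _ _) _.
  have <- : #|[set e : {set 'I_n} | #|e| == 2]| = 'C(n, 2).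
    by rewrite card_draws card_ord.
  by apply/subset_leq_card/subsetP=> e eE; rewrite inE sE.
exact: (@leq_bigmax_cond _ _ (fun k : 'I_('C(n, 2).+1) => k : nat)
         (Ordinal ltk)).
Qed.

Lemma planar_ar_attained n k :
  rainbow_free_colors n k -> rainbow_free_colors n (planar_ar n).
Proof.
move=> Hk; have := planar_ar_max Hk; rewrite /planar_ar.
elim/big_ind: _ => [|a b IHa IHb|i Hi _] //.
  by rewrite leqn0 => /eqP k0; rewrite -k0.
by case: (leqP a b) => ab le_k; [apply: IHb | apply: IHa].
Qed.

End AntiRamsey.

(* The matching with t edges, on the 2t vertices (i, false), (i, true). *)
Definition matching (t : nat) : {set {set 'I_t * bool}} :=
  [set [set (i, false); (i, true)] | i : 'I_t].

(* Main.v *)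
Require Import Defs.
From mathcomp Require Import all_boot all_fingroup.
From mathcomp Require Import zify.

(** Upper bound. One edge of each colour forms a planar graph G without t
    disjoint edges. Let M be a maximum matching of G, with m < t edges, and I
    the set of unmatched vertices. Since M has no augmenting path of length 3,
    if one end of an edge of M has two neighbours in I, then the other end has
    none. Let X be the set of ends with at least two neighbours in I.
    Planarity gives at most 6m - 6 edges inside V(M) and at most
    2(|X| + n - 2m) - 4 edges between X and I; the other edges contribute at
    most 2(m - |X|). The sum is 2n + 4m - 10. For n <= 4t - 8 the bound 3n - 6
    is enough.

    The two planar bounds come from Euler's inequality for the subgraphs F of a
    plane graph, proved by deleting edges one by one: a region is a class of
    darts under face tracing and under crossing the deleted edges, and an edge
    between two distinct regions is not a bridge of F, since the boundary of a
    region is a circulation.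

    Lower bound. Give distinct colours to the edges that meet a set S of t - 2
    hubs, and one further colour to all other edges: t disjoint edges then
    include two of the same colour. A triangulation with only n - 3t + 10 edges
    away from S is built by stacking: repeatedly insert a hub in a face of three
    hubs, fill two of the three new faces with non-hubs, finally fill the last
    one and place all remaining vertices in faces with two hubs. *)

Set Implicit Arguments.
Unset Strict Implicit.
Unset Printing Implicit Defensive.

(* lia preprocesses all hypotheses, which takes minutes in the contexts below. *)
Ltac card_lia := intros; repeat match goal with H : ?P |- _ =>
  lazymatch P with
  | is_true (leq _ _) => fail
  | @eq ?A _ _ => tryif unify A nat then fail else clear H
  | and _ _ => fail
  | _ => clear H
  end end; lia.

(** * Euler's inequality for subgraphs of a plane graph *)

Section Components.
Variable T : finType.
Implicit Types (e : rel T) (A : {set T}).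

Definition component e x : {set T} := [set y | connect e x y].

Definition components e A : {set {set T}} := component e @: A.

Lemma mem_component e x : x \in component e x.
Proof. by rewrite inE. Qed.

Lemma eq_component e x y :
  connect_sym e -> connect e x y -> component e x = component e y.
Proof. by move=> es xy; apply/setP=> z; rewrite !inE (same_connect es xy). Qed.

Lemma eq_components e e' A :
  connect e =2 connect e' -> components e A = components e' A.
Proof. by move=> ee; apply: eq_imset => x; apply/setP=> y; rewrite !inE ee. Qed.

Section AddEdge.
Variables (e e' : rel T) (x y : T).
Hypotheses (es : connect_sym e) (es' : connect_sym e').
Hypothesis (sub : subrel e e').
Hypothesis new : forall u v, e' u v ->
  [\/ connect e u v, u = x /\ v = y | u = y /\ v = x].

(** A path through the new edge can be shortened until it passes that edge at most once. *)
Lemma connect_add_edge u v : connect e' u v ->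
  [\/ connect e u v, connect e u x /\ connect e y v
    | connect e u y /\ connect e x v].
Proof.
case/connectP=> p; elim: p u => [|w p IH] u /=; first by move=> _ ->; constructor 1.
case/andP=> uw pw ev; have wv := IH _ pw ev.
case: (new uw) => [cuw | [-> ?] | [-> ?]]; subst.
- case: wv => [?|[? ?]|[? ?]].
  + by constructor 1; apply: connect_trans cuw _.
  + by constructor 2; split=> //; apply: connect_trans cuw _.
  + by constructor 3; split=> //; apply: connect_trans cuw _.
- case: wv => [?|[? ?]|[? ?]].
  + by constructor 2.
  + by constructor 2.
  + by constructor 1.
- case: wv => [?|[? ?]|[? ?]].
  + by constructor 3.
  + by constructor 1.
  + by constructor 3.
Qed.

Lemma connect_sub_add u v : connect e u v -> connect e' u v.
Proof. by apply: connect_sub => a b /sub; apply: connect1. Qed.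

(** The new edge merges at most two components. Once the component of [y] is set aside, sending a
    component to the [e']-component around it is injective. *)
Lemma leq_components_add A : #|components e A| <= #|components e' A|.+1.
Proof.
apply: leq_trans (_ : #|component e y |: (components e A :\ component e y)| <= _).
  by rewrite subset_leq_card //; apply/subsetP=> C; rewrite !inE; case: eqP.
rewrite cardsU1 !inE eqxx /= add1n ltnS.
pose f (C : {set T}) := \bigcup_(u in C) component e' u.
have fE u : f (component e u) = component e' u.
  apply/setP=> v; apply/bigcupP/idP=> [[w]|uv]; last by exists u;
    rewrite ?mem_component.
  by rewrite inE => /connect_sub_add uw; rewrite -(eq_component es' uw).
rewrite -(card_in_imset (f := f)).
  apply/subset_leq_card/subsetP=> _ /imsetP[C + ->].
  by rewrite !inE => /andP[_ /imsetP[u uA ->]]; rewrite fE imset_f.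
move=> C D /setD1P[uy /imsetP[u uA eu]] /setD1P[vy /imsetP[v vA ev]]; subst.
rewrite !fE => /setP/(_ v); rewrite mem_component inE.
case/connect_add_edge => [uv | [_ yv] | [uy' _]]; first exact: eq_component.
  by case/eqP: vy; rewrite (eq_component es yv).
by case/eqP: uy; rewrite (eq_component es uy').
Qed.

Lemma eq_connect_add : connect e x y -> connect e' =2 connect e.
Proof.
move=> xy u v; apply/idP/idP; last exact: connect_sub_add.
case/connect_add_edge => // [] [uz zv].
  exact: connect_trans uz (connect_trans xy zv).
by apply: connect_trans uz (connect_trans _ zv); rewrite es.
Qed.

End AddEdge.

End Components.

Lemma eq_set2 (T : finType) (u v x y : T) : [set u; v] = [set x; y] ->
  (u = x /\ v = y) \/ (u = y /\ v = x).
Proof.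
move=> /setP eq2; have := (eq2 u, eq2 v, eq2 x, eq2 y).
rewrite !inE !eqxx /= orbT => -[[[/esym /orP[]/eqP-> /esym /orP[]/eqP->]]].
- by move=> _; rewrite orbb ?orbT => /eqP->; left.
- by left.
- by right.
- by rewrite orbb => /eqP-> _; left.
Qed.

(** * Regions of a subgraph of a plane graph *)

Section PlaneSubgraph.
Variables (V : finType) (E : {set {set V}}) (r : {ffun V -> {perm V}}).
Hypotheses (sE : simple E) (planeE : plane_embedding E r).
Implicit Types (d : V * V) (F : {set {set V}}) (A W : {set V})
  (R : {set V * V}).

Let next := face_next r.
Let rev d := (d.2, d.1).

Lemma rev_dart F d : (rev d \in darts F) = (d \in darts F).
Proof. by rewrite !inE /adj /= setUC. Qed.

Lemma dart_next d : d \in darts E -> next d \in darts E.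
Proof.
case: d => x y; rewrite !inE /adj /= => xy.
case/and3P: planeE => _ /forallP/(_ y)/forallP/(_ x) rot _.
have yx : x \in nbhd E y by rewrite inE /adj setUC.
have /eqP := implyP rot yx => orb.
suff : r y x \in nbhd E y by rewrite inE.
by rewrite -orb -[r y x]/(aperm x (r y)) -{1}[r y]expg1 mem_porbit.
Qed.

Lemma adj_sym F : symmetric (adj F).
Proof. by move=> x y; rewrite /adj setUC. Qed.

Lemma adj_connect_sym F : connect_sym (adj F).
Proof. exact/sym_connect_sym/adj_sym. Qed.

(** The classes of this relation glue faces of [E] along the edges outside [F]. Both directions of
    [next] are allowed so that the relation is symmetric. *)
Definition across F : rel (V * V) := fun d d' =>
  [|| d' == next d, d == next d' | (d' == rev d) && (d \notin darts F)].

Lemma across_sym F : symmetric (across F).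
Proof.
move=> d d'; rewrite /across orbCA; congr [|| _, _ | _].
by apply/andP/andP=> -[/eqP->]; rewrite rev_dart; case: d d' => [? ?] [? ?].
Qed.

Lemma across_connect_sym F : connect_sym (across F).
Proof. exact/sym_connect_sym/across_sym. Qed.

Definition regions F := components (across F) (darts E).

Lemma connect_across_dart F d d' :
  connect (across F) d d' -> d \in darts E -> d' \in darts E.
Proof.
have H a b : across F a b -> a \in darts E -> b \in darts E.
  case/or3P => [/eqP-> /dart_next // | /eqP-> | /andP[/eqP-> _]];
    last by rewrite rev_dart.
  case: b => x y; rewrite inE /next /face_next /adj /= => yz.
  case/and3P: planeE => _ /forallP/(_ y)/forallP/(_ (r y x)) rot _.
  have yx : r y x \in nbhd E y by rewrite inE.
  have /eqP := implyP rot yx => orb.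
  have : x \in nbhd E y by rewrite -orb -porbit_sym -[r y x]/(aperm x (r y)) -{1}[r
    y]expg1 mem_porbit.
  by rewrite !inE /adj setUC.
case/connectP=> p; elim: p d => [|b p IH] d /=; first by move=> _ ->.
by case/andP=> db pb d'e dE; apply: (IH b pb d'e); apply: H db dE.
Qed.

(* A set of darts that is a union of faces enters and leaves A equally often;
   darts present together with their reverse cancel out. *)
Lemma circulation R A d : (forall d', d' \in R -> next d' \in R) ->
  d \in R -> rev d \notin R -> d.1 \notin A -> d.2 \in A ->
  exists d', [/\ d' \in R, rev d' \notin R, d'.1 \in A & d'.2 \notin A].
Proof.
move=> nR dR rdR d1 d2.
pose into := [set d in R | d.2 \in A]; pose out := [set d in R | d.1 \in A].
(* [next] maps the darts of [R] that end in [A] injectively to darts of [R] that start in [A]. *)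
have le_io : #|into| <= #|out|.
  rewrite -(card_imset _ (@face_next_inj _ r));
    apply/subset_leq_card/subsetP=> _ /imsetP[a + ->].
  by rewrite !inE => /andP[aR aA]; rewrite nR.
pose both := [set d in R | (d.1 \in A) && (d.2 \in A)].
have {le_io} : #|into :\: both| <= #|out :\: both|.
  rewrite !cardsD.
  have -> : into :&: both = both by apply/setP=> a; rewrite !inE;
    do !case: (_ \in _).
  have -> : out :&: both = both by apply/setP=> a; rewrite !inE;
    do !case: (_ \in _).
  exact: leq_sub2r.
(* If all leaving darts had their reverse in [R], reversal would embed them into the entering darts
   and miss [d], against the inequality just proved. *)
have [noout|] := boolP [forall a in out :\: both, rev a \in R].
  have revI : injective rev by case=> [? ?] [? ?] [-> ->].
  rewrite -[X in _ <= X](card_imset _ revI) leqNgt => /negP[].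
  apply/proper_card/properP; split.
    apply/subsetP=> _ /imsetP[a aout ->].
    have := forall_inP noout a aout; move: aout; rewrite !inE /=.
    by case: (a \in R) (a.1 \in A) (a.2 \in A) => [] [] [] //= _ ->.
  exists d; first by rewrite !inE dR d2 (negPf d1).
  by apply: contra rdR => /imsetP[a]; rewrite !inE => /andP[_ /andP[aR _]] ->;
    case: a aR.
rewrite negb_forall => /existsP[a]; rewrite negb_imply => /andP[aout raR] _.
exists a; move: aout raR; rewrite !inE.
by case: (a \in R) (a.1 \in A) (a.2 \in A) => [] [] [] //= _ ->.
Qed.

Lemma component_next F d d' :
  d' \in component (across F) d -> next d' \in component (across F) d.
Proof.
rewrite !inE => /connect_trans; apply; apply: connect1.
by rewrite /across eqxx.
Qed.

Lemma component_rev F d d' : d' \notin darts F ->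
  d' \in component (across F) d -> rev d' \in component (across F) d.
Proof.
move=> d'F; rewrite !inE => /connect_trans; apply; apply: connect1.
by rewrite /across eqxx d'F !orbT.
Qed.

(** For [F = E] no edge is crossed, so the regions are the faces, and connectedness leaves a single
    component. *)
Lemma euler_full : #|E| + #|components (adj E) setT| + 1 <= #|V| + #|regions E|.
Proof.
case/and3P: planeE => cE _ /eqP eul.
have -> : regions E = faces E r.
  apply: eq_in_imset => d dE; apply/setP=> d'; rewrite inE.
  apply/idP/idP => [|/porbitP[i ->]].
    case/connectP=> p; elim: p d dE => [|b p IH] d dE /=.
      by move=> _ ->; rewrite porbit_id.
    case/andP=> db pb d'e.
    have bE : b \in darts E by apply: (connect_across_dart (connect1 db) dE).
    have : b \in porbit (face_perm r) d.
      case/or3P: db => [/eqP->|/eqP->|/andP[_]]; last by rewrite dE.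
        have := mem_porbit (face_perm r) 1 d; rewrite expg1 permE //.
      by have := mem_porbit (face_perm r) 1 b; rewrite expg1 permE porbit_sym.
    rewrite -eq_porbit_mem => /eqP <-; exact: IH bE pb d'e.
  elim: i => [|i IH]; first by rewrite expg0 perm1.
  apply: (connect_trans IH); apply: connect1; rewrite expgSr permM /across.
  by rewrite [face_perm _ _]permE eqxx.
suff : #|components (adj E) setT| <= 1 by rewrite eul -addnA leq_add2l addn1 ltnS.
apply: (leq_trans _ (_ : #|[set [set: V]]| <= 1)); last by rewrite cards1.
apply/subset_leq_card/subsetP=> _ /imsetP[x _ ->]; rewrite inE; apply/eqP/setP=> y.
by rewrite !inE (forallP (forallP cE x) y).
Qed.

(** The lost edge pays for one more component or for one region less. If both sides of [e] lie in
    one region, the regions stay the same; otherwise the components do. *)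
Lemma euler_delete F e : F \subset E -> e \in F ->
  #|F| + #|components (adj F) setT| + 1 <= #|V| + #|regions F| ->
  #|F :\ e| + #|components (adj (F :\ e)) setT| + 1 <= #|V| + #|regions (F :\ e)|.
Proof.
move=> FE eF; rewrite (cardsD1 e F) eF.
have /cards2P[x [y [xy ee]]] : #|e| == 2 by apply: (forall_inP sE);
  apply: (subsetP FE).
set F' := F :\ e.
have F'F : F' \subset F by apply: subsetDl.
have newV u v : adj F u v -> [\/ connect (adj F') u v, u = x /\ v = y | u = y /\ v
  = x].
  move=> uv; case: (eqVneq [set u; v] e) => [ue|ue]; last first.
    by constructor 1; apply: connect1; rewrite /adj in_setD1 ue.
  by have [] := eq_set2 (etrans ue ee) => ?; [constructor 2 | constructor 3].
have subV : subrel (adj F') (adj F) by move=> u v /(subsetP F'F).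
have xyF : (x, y) \in darts F by rewrite inE /adj /= -ee.
have xyF' : (x, y) \notin darts F' by rewrite inE /adj /= -ee in_setD1 eqxx.
have subR : subrel (across F) (across F').
  move=> d d'; rewrite /across => /or3P[->|->|/andP[/eqP-> dF]]; rewrite ?orbT //.
  by rewrite eqxx /= (contra _ dF) ?orbT // !inE; apply: subV.
have newR d d' : across F' d d' ->
    [\/ connect (across F) d d', d = (x, y) /\ d' = (y, x) | d = (y, x) /\ d' = (x,
      y)].
  case/or3P=> [dd|dd|/andP[/eqP-> dF']]; try by constructor 1; apply: connect1;
    rewrite /across dd ?orbT.
  have [dF|dF] := boolP (d \in darts F); last by constructor 1; apply: connect1;
    rewrite /across eqxx dF !orbT.
  have : adj F d.1 d.2 by move: dF; rewrite inE.
  case: d dF dF' => u v dF dF' /= uv.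
  have ue : [set u; v] = e.
    by move: dF dF'; rewrite !inE /adj /= => uvF;
      rewrite !inE uvF andbT negbK => /eqP.
  by have [[-> ->]|[-> ->]] := eq_set2 (etrans ue ee);
    [constructor 2 | constructor 3].
have [same|diff] := boolP (connect (across F) (x, y) (y, x)).
  have -> : regions F' = regions F.
    by apply: eq_components; apply: (eq_connect_add _ subR newR same);
      exact: across_connect_sym.
  have := leq_components_add (@adj_connect_sym F') (@adj_connect_sym F) subV newV
    setT.
  card_lia.
have H := leq_components_add (@across_connect_sym F) (@across_connect_sym F') subR
  newR (darts E).
suff -> : components (adj F') setT = components (adj F) setT by rewrite /regions;
  card_lia.
suff conxy : connect (adj F') x y.
  by apply/esym/eq_components; apply: (eq_connect_add _ subV newV conxy);
    exact: adj_connect_sym.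
apply: contraNT diff => ncon.
(* Since [R] enters [A] along [(x, y)], [circulation] yields a dart of [R] that leaves [A] and has
   its reverse outside [R]. It belongs to [F], so it can only be [(y, x)], whose reverse is in
   [R]. *)
pose R := component (across F) (x, y); pose A := component (adj F') y.
case: (boolP ((y, x) \in R)) => [|ryx]; first by rewrite inE.
have [||[u v] []] := @circulation R A (x, y) (@component_next F (x, y))
  (mem_component _ _) ryx.
- by rewrite inE adj_connect_sym.
- exact: mem_component.
move=> /= uvR vuR; rewrite !inE => yu yv.
have uvF : (u, v) \in darts F.
  by apply: contraR vuR => /component_rev; apply.
have : adj F u v by move: uvF; rewrite inE.
case/newV => [uv|[ux _]|[uy vx]].
- by case/negP: yv; apply: connect_trans yu uv.
- by rewrite -ux adj_connect_sym yu in ncon.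
- by case/negP: vuR; rewrite uy vx mem_component.
Qed.

Lemma euler_subgraph F : F \subset E ->
  #|F| + #|components (adj F) setT| + 1 <= #|V| + #|regions F|.
Proof.
(* Induction on the number of edges of [E] missing from [F]: putting one back reduces the claim to
   [euler_delete]. *)
move: {2}#|E :\: F| (erefl #|E :\: F|) => k; elim: k F => [|k IH] F.
  move/eqP; rewrite cards_eq0 setD_eq0 => EF FE.
  have -> : F = E by apply/eqP; rewrite eqEsubset FE.
  exact: euler_full.
move=> FD FE; have /card_gt0P[e] : 0 < #|E :\: F| by rewrite FD.
case/setDP=> eE eF.
have eFE : e |: F \subset E by rewrite subUset sub1set eE.
have -> : F = (e |: F) :\ e by rewrite setU1K.
apply: euler_delete => //; first exact: setU11.
apply: IH => //.
have : #|E :\: F| = #|(E :\: F) :\ e|.+1 by rewrite (cardsD1 e) !inE eF eE.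
by rewrite FD setDDl setUC => -[].
Qed.
End PlaneSubgraph.

(** * Edge bounds for planar and bipartite planar graphs *)

Section EdgeBounds.
Variables (V : finType) (E : {set {set V}}) (r : {ffun V -> {perm V}}).
Hypotheses (sE : simple E) (planeE : plane_embedding E r).
Variables (F : {set {set V}}) (W : {set V}).
Hypotheses (FE : F \subset E) (FW : forall e, e \in F -> e \subset W).

Lemma adj_neq (x y : V) : adj F x y -> x != y.
Proof.
move=> /(subsetP FE) /(forall_inP sE); by rewrite cards2; case: (x == y).
Qed.

Lemma adj_cover (x y : V) : adj F x y -> (x \in W) && (y \in W).
Proof. by move=> /FW; rewrite subUset !sub1set. Qed.

Lemma card_darts : #|darts F| = 2 * #|F|.
Proof.
pose edge (d : V * V) := [set d.1; d.2].
rewrite -sum1_card (partition_big edge [in F]) /=; last by move=> d; rewrite inE.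
rewrite mulnC -sum_nat_const; apply: eq_bigr => e eF; rewrite sum1dep_card.
have /cards2P[x [y [xy ee]]] : #|e| == 2 by apply: (forall_inP sE);
  apply: (subsetP FE).
have -> : 2 = #|[set (x, y); (y, x)]| by rewrite cards2 xpair_eqE (negPf xy).
apply: eq_card => -[u v]; rewrite !inE /edge /adj /=;
  apply/andP/orP => [[_ /eqP uv]|].
  by case: (eq_set2 (etrans uv ee)) => -[-> ->]; rewrite eqxx; [left | right].
by case=> /eqP[-> ->]; rewrite 1?[[set y; x]]setUC -ee eqxx.
Qed.

(** Every vertex outside [W] is isolated and forms a component of its own; the component of [w] is
    one more. *)
Lemma card_components_cover w : w \in W ->
  #|V| + 1 <= #|components (adj F) setT| + #|W|.
Proof.
move=> wW.
suff : #|w |: ~: W| <= #|components (adj F) setT|.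
  by rewrite cardsU1 !inE wW /= -(cardsC W); card_lia.
rewrite -(card_in_imset (f := component (adj F))).
  by apply/subset_leq_card/imsetS/subsetT.
have isol x y : x \notin W -> connect (adj F) x y -> x = y.
  move=> xW /connectP[[|z p]] //= /andP[/adj_cover]; by rewrite (negPf xW).
move=> x y xW yW xy.
have cxy : connect (adj F) x y by have /setP/(_ y) := xy;
  rewrite !inE connect0 => ->.
have cyx : connect (adj F) y x by rewrite adj_connect_sym.
case/setU1P: xW => [xw|]; last by rewrite inE => /isol; apply.
case/setU1P: yW => [yw|]; last by rewrite inE => /isol yW; apply/esym/yW.
by rewrite xw yw.
Qed.

(** A region without such a dart is closed under reversal as well as under [next]. Connectedness of
    [E] then spreads it over all darts, so it is the only region. *)
Lemma region_boundary R : 1 < #|regions E r F| -> R \in regions E r F ->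
  exists2 d, d \in R & (d.2, d.1) \notin R.
Proof.
move=> two /imsetP[d0 d0E ->].
apply/exists_inP; apply: contraTT two; rewrite negb_exists_in => /forall_inP closed.
rewrite -leqNgt; apply: (@leq_trans #|[set component (across r F) d0]|);
  last by rewrite cards1.
apply/subset_leq_card/subsetP=> _ /imsetP[d dE ->]; rewrite inE.
set R0 := component _ d0.
have revR x y : (x, y) \in R0 -> (y, x) \in R0 by move=> /closed; rewrite negbK.
(* Reversal followed by [next] rotates a dart about its tail. *)
have rotR x y z : (x, y) \in R0 -> adj E x y -> adj E x z -> (x, z) \in R0.
  move=> xy aE zE; case/and3P: planeE => _ /forallP/(_ x)/forallP/(_ y) rot _.
  have yx : y \in nbhd E x by rewrite inE.
  have /eqP orb := implyP rot yx.
  have : z \in nbhd E x by rewrite inE.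
  rewrite -orb => /porbitP[i ->] {z zE}; elim: i => [|i IH];
    first by rewrite expg0 perm1.
  by rewrite expgSr permM; apply: (component_next (revR _ _ IH)).
have dartR x y : connect (adj E) d0.1 x -> adj E x y -> (x, y) \in R0.
  case/connectP=> p; rewrite inE in d0E.
  have : (d0.1, d0.2) \in R0 by rewrite -surjective_pairing mem_component.
  elim: p d0.1 d0.2 d0E => [|z p IH] u v uv uvR /=.
    by move=> _ ->; apply: rotR uvR uv.
  move=> /andP[uz pz] xe; apply: (IH z u) => //; first by rewrite adj_sym.
  exact: revR (rotR _ _ _ uvR uv uz).
have dR : d \in R0.
  case: d dE => x y; rewrite inE => xy; apply: dartR => //.
  by case/and3P: planeE => cE _ _; apply: (forallP (forallP cE d0.1)).
apply/eqP/esym/eq_component; first exact: across_connect_sym.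
by move: dR; rewrite inE.
Qed.

(** This is [circulation] for the single vertex [y]. The dart found does not lead back to [x],
    because [(y, x)] is outside [R]. *)
Lemma boundary_next R x y : R \in regions E r F -> (x, y) \in R -> (y, x) \notin R
  ->
  exists z, [/\ (y, z) \in R :&: darts F, (z, y) \notin R, x != z & y != z].
Proof.
case/imsetP=> d _ ->; set R0 := component _ _ => xyR yxR.
have bF u v : (u, v) \in R0 -> (v, u) \notin R0 -> (u, v) \in darts F.
  by move=> uvR; apply: contraR => /component_rev; apply.
have xy : x != y by apply: adj_neq; move: (bF _ _ xyR yxR); rewrite inE.
have [||[u z] []] := @circulation V r R0 [set y] (x, y) (@component_next V r F d)
  xyR yxR.
- by rewrite inE.
- by rewrite inE.
rewrite /= => yzR zyR /set1P uy; rewrite uy in yzR zyR *; rewrite inE => zy;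
  exists z; split=> //.
- by rewrite in_setI yzR bF.
- by apply: contraNneq yxR => ->.
- by rewrite eq_sym.
Qed.

(** A boundary dart is continued three times. As the walk never turns straight back, the three darts
    found are distinct. *)
Lemma region_ge3 R : 1 < #|regions E r F| -> R \in regions E r F ->
  3 <= #|R :&: darts F|.
Proof.
move=> two RR; have [[x0 x] xR x'R] := region_boundary two RR.
have [y [xyR yxR yx0 yx]] := boundary_next RR xR x'R.
have [z [yzR zyR zx zy]] := boundary_next RR (setIP xyR).1 yxR.
have [w [zwR wzR wy wz]] := boundary_next RR (setIP yzR).1 zyR.
have <- : size [:: (x, y); (y, z); (z, w)] = 3 by [].
rewrite cardE; apply: uniq_leq_size.
  by rewrite /= !inE !xpair_eqE !negb_or
    (negPf yx) (negPf zx) (negPf zy).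
by apply/allP; rewrite /= !mem_enum xyR yzR zwR.
Qed.

Lemma region_ge4 (B : {set V}) R :
  (forall x y, adj F x y -> (x \in B) != (y \in B)) ->
  1 < #|regions E r F| -> R \in regions E r F -> 4 <= #|R :&: darts F|.
Proof.
move=> bip two RR; have [[x0 x] xR x'R] := region_boundary two RR.
have [y [xyR yxR yx0 yx]] := boundary_next RR xR x'R.
have [z [yzR zyR zx zy]] := boundary_next RR (setIP xyR).1 yxR.
have [w [zwR wzR wy wz]] := boundary_next RR (setIP yzR).1 zyR.
have [v [wvR vwR vz vw]] := boundary_next RR (setIP zwR).1 wzR.
(* Three edges change sides three times, so the walk cannot be back at [x]. *)
have wx : x != w.
  apply/eqP=> wx; case/setIP: xyR zwR yzR => _ + /setIP[_ +] /setIP[_ +].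
  rewrite -wx !inE => /bip + /bip + /bip.
  by case: (x \in B); case: (y \in B); case: (z \in B).
have <- : size [:: (x, y); (y, z); (z, w); (w, v)] = 4 by [].
rewrite cardE; apply: uniq_leq_size.
  by rewrite /= !inE !xpair_eqE !negb_or
    (negPf yx) (negPf zx) (negPf wx) (negPf zy) (negPf wy) (negPf wz).
by apply/allP; rewrite /= !mem_enum xyR yzR zwR wvR.
Qed.

Lemma sum_regions g : (forall R, R \in regions E r F -> g <= #|R :&: darts F|) ->
  #|regions E r F| * g <= #|darts F|.
Proof.
move=> big; rewrite -sum_nat_const -[X in _ <= X]sum1_card.
rewrite (partition_big (component (across r F)) [in regions E r F]) /=; last first.
  by move=> d dF; apply: imset_f; move: dF; rewrite !inE; apply: (subsetP FE).
apply: leq_sum => R RR; rewrite sum1dep_card; apply: (leq_trans (big R RR)).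
apply/subset_leq_card/subsetP=> d /setIP[dR dF]; rewrite inE dF /=.
case/imsetP: RR dR => d0 _ ->; rewrite inE => dd0.
by apply/eqP/esym/eq_component => //; apply: across_connect_sym.
Qed.

(** Here [f] is the number of regions. Eliminating it gives [3 * #|W| - 6] for [g = 3] and
    [2 * #|W| - 4] for [g = 4]. The first alternative is the case of at most one region. *)
Lemma edges_le_cover g :
  (forall R, 1 < #|regions E r F| -> R \in regions E r F ->
    g <= #|R :&: darts F|) ->
  0 < #|W| -> #|F| < #|W| \/
  exists f, #|F| + 2 <= #|W| + f /\ f * g <= 2 * #|F|.
Proof.
move=> big /card_gt0P[w wW].
have eul := euler_subgraph sE planeE FE; have := card_components_cover wW => cc.
case: (leqP #|regions E r F| 1) => [le1|two].
  left; apply/leP; card_lia.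
right; exists #|regions E r F|; split; first by card_lia.
by rewrite -card_darts; apply: sum_regions => R; apply: big.
Qed.

(** This form holds for every size of [W]; it serves the case where the maximum matching covers at
    most two vertices. *)
Lemma planar_edges_le : #|F| <= 3 * #|W|.
Proof.
have [->|[e eF]] := set_0Vmem F; first by rewrite cards0.
have W0 : 0 < #|W|.
  have /eqP : #|e| == 2 by apply: (forall_inP sE); apply: (subsetP FE).
  have := subset_leq_card (FW eF); card_lia.
have [|[f]] := edges_le_cover region_ge3 W0; card_lia.
Qed.

Lemma planar_edges_bound : 2 < #|W| -> #|F| + 6 <= 3 * #|W|.
Proof.
move=> W3; have W0 : 0 < #|W| by apply: leq_trans W3.
have [|[f]] := edges_le_cover region_ge3 W0; card_lia.
Qed.

Lemma bipartite_edges_bound (B : {set V}) :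
  (forall x y, adj F x y -> (x \in B) != (y \in B)) ->
  2 < #|W| -> #|F| + 4 <= 2 * #|W|.
Proof.
move=> bip W3; have W0 : 0 < #|W| by apply: leq_trans W3.
have [|[f]] := edges_le_cover (fun R => @region_ge4 B R bip) W0; card_lia.
Qed.
End EdgeBounds.

(** * Edges of a planar graph with a given matching number *)

Lemma leq_card_bigcup (I T : finType) (A : {set I}) (B : I -> {set T}) :
  #|\bigcup_(i in A) B i| <= \sum_(i in A) #|B i|.
Proof.
elim/big_rec2: _ => [|i m U _ IH]; first by rewrite cards0.
by apply: leq_trans (leq_add (leqnn _) IH); rewrite cardsU leq_subr.
Qed.

Lemma simple_edge (V : finType) (F : {set {set V}}) e : simple F -> e \in F ->
  exists x y, x != y /\ e = [set x; y].
Proof. by move=> /forall_inP sF /sF /cards2P. Qed.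

Lemma trivIset_add_edge (V : finType) (M : {set {set V}}) x y :
    trivIset M -> set0 \notin M -> x \notin cover M -> y \notin cover M ->
  [/\ trivIset ([set x; y] |: M), set0 \notin [set x; y] |: M,
      cover ([set x; y] |: M) = [set x; y] :|: cover M
    & #|[set x; y] |: M| = #|M|.+1].
Proof.
move=> tM M0 xM yM; have [e eM|tM' eM] := @trivIsetU1 _ [set x; y] M _ tM M0.
  rewrite -setI_eq0; apply/eqP/setP=> z; rewrite !inE; apply/negP=> /andP[zxy ze].
  have zC : z \in cover M by apply/bigcupP; exists e.
  by case/orP: zxy zC => /eqP->; apply/negP.
split=> //; last by rewrite cardsU1 eM.
  rewrite in_setU1 negb_or M0 andbT; apply/eqP=> /setP/(_ x).
  by rewrite !inE eqxx.
by rewrite /cover big_setU1.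
Qed.

Section MatchingExtremal.
Variables (V : finType) (E : {set {set V}}) (r : {ffun V -> {perm V}}).
Hypotheses (sE : simple E) (planeE : plane_embedding E r).
Variables (G M : {set {set V}}).
Hypotheses (GE : G \subset E) (MG : M \subset G) (tM : trivIset M).
Hypothesis maxM : forall M' : {set {set V}},
  M' \subset G -> trivIset M' -> #|M'| <= #|M|.

Let C := cover M.

Let outer u := [set x | (x \notin C) && adj G u x].

Let sG : simple G.
Proof. by apply/forall_inP=> e /(subsetP GE); apply: (forall_inP sE). Qed.

Let set0M : set0 \notin M.
Proof. by apply/negP=> /(subsetP MG) /(forall_inP sG); rewrite cards0. Qed.

Lemma card_cover_matching : #|C| = 2 * #|M|.
Proof.
rewrite -(eqP tM) mulnC -sum_nat_const; apply: eq_bigr => e eM.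
by apply/eqP/(forall_inP sG)/(subsetP MG).
Qed.

Lemma outer_edge_free x y : x \notin C -> y \notin C -> ~~ adj G x y.
Proof.
move=> xC yC; apply/negP; rewrite /adj => xy.
have [tM' _ _ cM'] := trivIset_add_edge tM set0M xC yC.
by have := maxM _ tM'; rewrite cM' ltnn subUset sub1set MG xy => /(_ isT).
Qed.

(** If [x] and [y] differed, exchanging [uv] for [ux] and [vy] would enlarge the matching. *)
Lemma no_augmenting_path u v x y : [set u; v] \in M -> u != v ->
  x \in outer u -> y \in outer v -> x = y.
Proof.
move=> uvM uv; rewrite !inE => /andP[xC ux] /andP[yC vy]; apply/eqP/negPn/negP=> xy.
have nC a b : a \in C -> b \notin C -> (a == b) = false.
  by move=> aC bC; apply: contraNF bC => /eqP <-.
have uC : u \in C by apply/bigcupP; exists [set u; v]; rewrite ?set21.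
have vC : v \in C by apply/bigcupP; exists [set u; v]; rewrite ?set22.
set M1 := M :\ [set u; v].
have tM1 : trivIset M1 by apply: trivIsetS tM; apply: subsetDl.
have M01 : set0 \notin M1 by rewrite inE negb_and set0M orbT.
have C1 : cover M1 = C :\: [set u; v] by rewrite coverD1.
have uM1 : u \notin cover M1 by rewrite C1 !inE eqxx.
have xM1 : x \notin cover M1 by rewrite C1 in_setD negb_and xC orbT.
have [tM2 M02 C2 cM2] := trivIset_add_edge tM1 M01 uM1 xM1.
have vM2 : v \notin cover ([set u; x] |: M1).
  by rewrite C2 C1 !inE eqxx orbT eq_sym (negPf uv) (nC v x).
have yM2 : y \notin cover ([set u; x] |: M1).
  by rewrite C2 C1 !inE (negPf yC) andbF orbF negb_or eq_sym (nC u y) // eq_sym.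
have [tM3 _ _ cM3] := trivIset_add_edge tM2 M02 vM2 yM2.
suff /maxM/(_ tM3) : [set v; y] |: ([set u; x] |: M1) \subset G.
  by rewrite cM3 cM2 (cardsD1 [set u; v] M) uvM ltnn.
rewrite !subUset !sub1set; apply/and3P; split=> //.
exact: subset_trans (subsetDl _ _) MG.
Qed.

Let X := [set u in C | 1 < #|outer u|].

(** If one end has two outer neighbours, [no_augmenting_path] leaves none for the other end;
    otherwise each end has at most one. *)
Lemma matching_edge_weight e : e \in M ->
  \sum_(u in e) (if u \in X then 2 else #|outer u|) <= 2.
Proof.
move=> eM; have [u [v [uv ee]]] := simple_edge sG (subsetP MG _ eM).
rewrite ee big_setU1 ?inE //= big_set1.
have uC : u \in C by apply/bigcupP; exists e; rewrite // ee set21.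
have vC : v \in C by apply/bigcupP; exists e; rewrite // ee set22.
rewrite !inE uC vC /=.
have key a b : [set a; b] \in M -> a != b -> 1 < #|outer a| -> #|outer b| = 0.
  move=> abM ab /card_gt1P[x [y [xa ya xy]]]; apply: eq_card0 => z.
  apply/negP=> zb; case/eqP: xy.
  by rewrite (no_augmenting_path abM ab xa zb) (no_augmenting_path abM ab ya zb).
rewrite ee in eM.
case: (ltnP 1 #|outer u|) => [u1|u1]; first by rewrite (key u v).
case: (ltnP 1 #|outer v|) => [v1|v1];
  first by rewrite (key v u) // 1?setUC // eq_sym.
card_lia.
Qed.

Lemma matching_weight :
  2 * #|X| + \sum_(u in C :\: X) #|outer u| <= 2 * #|M|.
Proof.
have XC : X \subset C by apply/subsetP=> u; rewrite inE => /andP[].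
have : \sum_(u in C) (if u \in X then 2 else #|outer u|) <= 2 * #|M|.
  rewrite big_trivIset //= mulnC -sum_nat_const.
  exact: leq_sum matching_edge_weight.
apply: leq_trans.
rewrite [leqRHS](big_setID X) /= (setIidPr XC) leq_add //.
  by rewrite mulnC -sum_nat_const; apply: leq_sum => u ->.
by apply: leq_sum => u /setDP[_ /negPf ->].
Qed.

(** By [outer_edge_free] every edge of [G] has an end in [C]. Those with only one such end are split
    according to whether it lies in [X]. *)
Lemma edges_split : #|G| <= #|[set e in G | e \subset C]| +
  #|[set e in G | [exists u in X, exists x in ~: C, e == [set u; x]]]| +
  \sum_(u in C :\: X) #|outer u|.
Proof.
set G0 := [set e in G | e \subset C]; set G1 := [set e in G | _].
pose G2 := \bigcup_(u in C :\: X) [set [set u; x] | x in outer u].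
have GS : G \subset G0 :|: G1 :|: G2.
  apply/subsetP=> e eG; have [x [y [xy ee]]] := simple_edge sG eG.
  wlog yC : x y xy ee / y \notin C.
    move=> IH; have [yC|] := boolP (y \in C); last exact: (IH x y).
    have [xC|xC] := boolP (x \in C); last by apply: (IH y x);
      rewrite // 1?eq_sym // setUC.
    by rewrite !inE eG ee subUset !sub1set xC yC.
  have [xC|xC] := boolP (x \in C); last by have := outer_edge_free xC yC;
    rewrite /adj -ee eG.
  have [xX|xX] := boolP (x \in X).
    apply/setUP; left; apply/setUP; right; rewrite inE eG.
    by apply/exists_inP; exists x => //; apply/exists_inP; exists y;
      rewrite ?inE ?ee.
  apply/setUP; right; apply/bigcupP; exists x; first by apply/setDP.
  by apply/imsetP; exists y => //; rewrite inE yC /adj -ee.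
apply: leq_trans (subset_leq_card GS) _.
rewrite (leq_trans (leq_card_setU _ _)) // leq_add ?(leq_card_setU G0 G1) //.
apply: leq_trans (leq_card_bigcup _ _) _.
apply: leq_sum => u _; exact: leq_imset_card.
Qed.

Lemma matching_extremal t : #|M| < t -> 6 <= t -> 4 * t - 7 <= #|V| ->
  #|G| <= 2 * #|V| + 4 * t - 14.
Proof.
move=> Mt t6 nt; have := edges_split; have := matching_weight.
set G0 := [set e in G | e \subset C]; set G1 := [set e in G | _].
have C2 := card_cover_matching; have CC := cardsC C.
have G0E : G0 \subset E by apply: subset_trans GE; apply/subsetP=> e;
  rewrite inE => /andP[].
have G1E : G1 \subset E by apply: subset_trans GE; apply/subsetP=> e;
  rewrite inE => /andP[].
have G0C e : e \in G0 -> e \subset C by rewrite inE => /andP[].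
have XC : [disjoint X & ~: C].
  by rewrite disjoints_subset setCK; apply/subsetP=> u; rewrite inE => /andP[].
have cW : #|X :|: ~: C| = #|X| + #|~: C| by apply/eqP;
  rewrite (leq_card_setU X (~: C)).
have G1W e : e \in G1 -> e \subset X :|: ~: C.
  rewrite inE => /andP[_ /exists_inP[u uX /exists_inP[x xC /eqP->]]].
  by rewrite subUset !sub1set !(in_setU, uX, xC) orbT.
have bip x y : adj G1 x y -> (x \in X) != (y \in X).
  rewrite /adj inE => /andP[_ /exists_inP[u uX /exists_inP[z zC /eqP]]].
  have zX := disjointFl XC zC.
  by case/eq_set2=> -[-> ->]; rewrite uX zX.
have b1 := bipartite_edges_bound sE planeE G1E G1W bip.
have b0 := planar_edges_le sE planeE G0E G0C.
have b0' := planar_edges_bound sE planeE G0E G0C.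
(* The covering set is large enough, since [#|~: C| >= 2 * t - 5]. *)
have b1' : #|G1| + 4 <= 2 * #|X :|: ~: C| by apply: b1; card_lia.
(* For [m = #|M| <= 1] only [6 * m] bounds the edges inside [C]; the total [2 * n + 4 * m - 4], with
   [n = #|V|], still suffices because [t >= 6]. *)
case: (leqP #|M| 1) => M1; first by card_lia.
have b0'' : #|G0| + 6 <= 3 * #|C| by apply: b0'; card_lia.
card_lia.
Qed.
End MatchingExtremal.

(** * Rainbow matchings and the upper bound *)

Lemma matching_copy (V : finType) (M : {set {set V}}) t :
  simple M -> trivIset M -> t <= #|M| ->
  exists phi : {ffun 'I_t * bool -> V}, injective phi /\
    forall e, e \in matching t -> phi @: e \in M.
Proof.
move=> sM tM tleM; pose f (i : 'I_t) := enum_val (widen_ord tleM i).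
have fM i : f i \in M by apply: enum_valP.
have f_inj : injective f.
  by move=> i j /enum_val_inj /(congr1 val) /= /val_inj.
have [p pP] : exists p : 'I_t -> V * V,
    forall i, (p i).1 != (p i).2 /\ f i = [set (p i).1; (p i).2].
  apply: (fin_all_exists (U := fun=> (V * V)%type)
    (P := fun i (p : V * V) => p.1 != p.2 /\ f i = [set p.1; p.2])) => i.
  by have [x [y H]] := simple_edge sM (fM i); exists (x, y).
exists [ffun ib => if ib.2 then (p ib.1).2 else (p ib.1).1].
have in_f i b : (if b then (p i).2 else (p i).1) \in f i.
  by rewrite (pP i).2; case: b; rewrite !inE eqxx ?orbT.
split=> [[i b] [j b']|e /imsetP[i _ ->]];
  last by rewrite imsetU1 imset_set1 !ffunE -(pP i).2.
rewrite !ffunE /= => eqp; have ij : i = j.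
  apply/eqP/negPn/negP=> ij.
  have dis : [disjoint f i & f j].
    by apply: (trivIsetP tM); rewrite ?fM // (inj_eq f_inj).
  by have := disjointFr dis (in_f i b); rewrite eqp in_f.
move: eqp; rewrite -ij; have := (pP i).1.
by case: b b' => [] [] //= => [/eqP ne /esym|/eqP ne] /ne.
Qed.

Lemma rainbow_free_colors_le t n k : 6 <= t -> 3 * t - 6 <= n ->
  rainbow_free_colors (matching t) n k -> k <= 2 * n + 4 * t - 14.
Proof.
move=> t6 nt /existsP[E /and3P[/andP[sE /existsP[r /andP[plE _]]] _]].
case/existsP=> c /andP[/eqP cE norainbow].
(* [g] selects one edge of each colour, so [G] is rainbow with [k] edges, and [t] disjoint edges of
   [G] would be a rainbow copy. *)
have [g gP] : exists g : 'I_k -> {set 'I_n}, forall j, g j \in E /\ c (g j) = j.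
  apply: (fin_all_exists (U := fun=> {set 'I_n}) (P
    := fun j e => e \in E /\ c e = j)) => j.
  have : j \in c @: E by rewrite cE.
  by case/imsetP=> e eE ->; exists e.
have g_inj : injective g by apply: (can_inj (g := c)) => j; case: (gP j).
pose G := [set g j | j : 'I_k].
have GE : G \subset E by apply/subsetP=> _ /imsetP[j _ ->]; case: (gP j).
have cG : #|G| = k by rewrite card_imset // card_ord.
have [n4|n4] := leqP (4 * t - 7) n; last first.
  have := planar_edges_bound sE plE GE (fun e _ => subsetT e).
  have n3 : 2 < n by card_lia.
  rewrite cG cardsT card_ord => /(_ n3); card_lia.
pose P (M : {set {set 'I_n}}) := (M \subset G) && trivIset M.
have P0 : P set0 by rewrite /P sub0set; apply/trivIsetP=> A B; rewrite inE.
case: (arg_maxnP (fun M : {set {set 'I_n}} => #|M|) P0) => M /andP[MG tM] maxM.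
have sM : simple M.
  by apply/forall_inP=> e /(subsetP MG) /(subsetP GE); apply: (forall_inP sE).
have Mt : #|M| < t.
  rewrite ltnNge; apply: contra norainbow => /(matching_copy sM tM)[phi [phi_inj
    phiM]].
  apply/existsP; exists phi; apply/andP; split.
    apply/andP; split; first exact/injectiveP.
    by apply/forall_inP=> e /phiM /(subsetP MG) /(subsetP GE).
  apply/forall_inP=> e /phiM /(subsetP MG) /imsetP[j _ ej].
  apply/forall_inP=> e' /phiM /(subsetP MG) /imsetP[j' _ ej']; apply/implyP.
  rewrite ej ej' (gP j).2 (gP j').2 => /eqP jj; rewrite -{}jj -{}ej in ej'.
  by apply/eqP/(imset_inj phi_inj).
rewrite -[k in k <= _]cG.
have := @matching_extremal _ E r sE plE G M GE MG tM _ t Mt t6.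
rewrite card_ord; apply=> // M' M'G tM'; apply: maxM; exact/andP.
Qed.

(** * Stacked triangulations *)

(* By tri_face all faces are triangles, and tri_card then amounts to Euler's
   formula. *)
Record triangulates (V : finType) (U : {set V}) (E : {set {set V}})
    (r : {ffun V -> {perm V}}) : Prop := Triangulates {
  tri_simple : simple E;
  tri_cover : forall e, e \in E -> e \subset U;
  tri_connect : {in U &, forall x y, connect (adj E) x y};
  tri_fix : forall x y, ~~ adj E x y -> r x y = y;
  tri_orbit : forall x y z, adj E x y -> adj E x z -> z \in porbit (r x) y;
  tri_face : forall x y, adj E x y -> r (r y x) y = x /\ r x (r y x) = y;
  tri_card : #|E| + 6 = 3 * #|U|
}.

Section Triangulates.
Variables (V : finType) (U : {set V}) (E : {set {set V}}).
Variable (r : {ffun V -> {perm V}}).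
Hypothesis triE : triangulates U E r.

Lemma tri_rot x y : adj E x y -> adj E x (r x y).
Proof.
apply: contraTT => nadj; have := tri_fix triE nadj.
by move/perm_inj=> yE; rewrite -yE.
Qed.

Lemma tri_neq x y : adj E x y -> x != y.
Proof. by move=> xy; apply: (adj_neq (tri_simple triE) _ xy). Qed.

Lemma tri_adjU x y : adj E x y -> (x \in U) && (y \in U).
Proof. exact: (adj_cover (tri_cover triE)). Qed.

Lemma tri_nbhd x y : adj E x y -> porbit (r x) y = nbhd E x.
Proof.
move=> xy; apply/setP=> z; rewrite [RHS]inE; apply/idP/idP;
  last by move/(tri_orbit triE xy).
case/porbitP=> i ->; elim: i => [|i IH]; first by rewrite expg0 perm1.
by rewrite expgSr permM tri_rot.
Qed.

Lemma tri_face_orbit x y : adj E x y ->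
  porbit (face_perm r) (x, y) = [set (x, y); (y, r y x); (r y x, x)].
Proof.
move=> xy; have [rz rx] := tri_face triE xy.
apply/setP=> d; apply/idP/idP => [/porbitP[i ->]|].
  elim: i => [|i IH]; first by rewrite expg0 perm1 !inE eqxx.
  move: IH; rewrite expgSr permM !inE -orbA => /or3P[] /eqP->;
    by rewrite permE /face_next /= ?rz ?rx eqxx ?orbT.
have next1 : face_perm r (x, y) = (y, r y x) by rewrite permE.
have next2 : face_perm r (y, r y x) = (r y x, x) by rewrite permE /face_next /= rz.
rewrite !inE -orbA => /or3P[] /eqP->; first exact: porbit_id.
  by rewrite -next1; have := mem_porbit (face_perm r) 1 (x, y); rewrite expg1.
by rewrite -next2 -next1 -permM; have := mem_porbit (face_perm r) 2 (x, y).
Qed.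

Lemma triangulates_plane : U = setT -> 0 < #|V| -> plane_triangulation E.
Proof.
move=> UT V0; rewrite /plane_triangulation (tri_simple triE); apply/existsP;
  exists r.
have face3 f : f \in faces E r -> #|f| = 3.
  case/imsetP=> -[x y]; rewrite inE /= => xy ->; rewrite tri_face_orbit //.
  have yx : adj E y x by rewrite adj_sym.
  have yz := tri_rot yx; have [rz _] := tri_face triE xy.
  have zx : adj E (r y x) x by rewrite -[X in adj E _ X]rz tri_rot // adj_sym.
  rewrite setUC cardsU1 cards2 !inE !xpair_eqE negb_or.
  by rewrite (negPf (tri_neq zx)) (negPf (tri_neq xy)) [r y x == y]eq_sym (negPf
    (tri_neq yz)).
apply/andP; split; last by apply/forall_inP=> f /face3 ->.
apply/and3P; split.
- apply/forallP=> x; apply/forallP=> y; apply: (tri_connect triE); by rewrite UT.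
- apply/forallP=> x; apply/forallP=> y; apply/implyP; rewrite inE => xy.
  by rewrite tri_nbhd.
(* Each dart lies in exactly one face. With [2 * #|E|] darts and [tri_card] this gives
   [2 * #|V| - 4] faces. *)
have cd : #|darts E| = #|faces E r| * 3.
  rewrite -sum_nat_const -sum1_card.
  rewrite (partition_big (porbit (face_perm r)) [in faces E r]) /=; last first.
    by move=> d dE; apply: imset_f.
  apply: eq_bigr => f fF; rewrite sum1dep_card -(face3 f fF).
  apply: eq_card => d; rewrite inE; case/imsetP: fF => d0 d0E ->.
  rewrite eq_porbit_mem andbC; have [dd|] /= := boolP (d \in _); last by [].
  case: d0 d0E dd => x y; rewrite !inE /= => xy;
    rewrite tri_face_orbit // !inE -orbA.
  have yx : adj E y x by rewrite adj_sym.
  have yz := tri_rot yx; have [rz _] := tri_face triE xy.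
  have zx : adj E (r y x) x by rewrite -[X in adj E _ X]rz tri_rot // adj_sym.
  by case/or3P=> /eqP->.
have := card_darts (tri_simple triE) (subxx _); have := tri_card triE.
rewrite UT cardsT cd => ? ?; apply/eqP; card_lia.
Qed.

End Triangulates.

(** The turn at [y] is that of [face_next]. In a triangulation, [tri_face] makes this the oriented
    face [x], [y], [z]. *)
Definition facial (V : finType) (E : {set {set V}}) (r : {ffun V -> {perm V}})
  (x y z : V) := adj E x y && (r y x == z).

(** * Inserting a vertex into a triangular face *)

Section Stack.
Variables (V : finType) (U : {set V}) (E : {set {set V}}).
Variable (r : {ffun V -> {perm V}}).
Hypothesis triE : triangulates U E r.
Variables (v a b c : V).
Hypotheses (vU : v \notin U) (face_abc : facial E r a b c).

Let T := [set a; b; c].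

Definition stack_edges : {set {set V}} := E :|: [set [set v; x] | x in T].

(** The next corner along the face; it lets one argument treat the three symmetric corners. *)
Let turn x := if x == a then b else if x == b then c else a.

(* Around the corner x of the face (a, b, c), the new vertex v is inserted just
   before turn x. *)
Definition stack_rotation : {ffun V -> {perm V}} :=
  [ffun x => if x == v then (tperm a b * tperm b c)%g
             else if x \in T then (r x * tperm v (turn x))%g else r x].

Local Notation E' := stack_edges.
Local Notation r' := stack_rotation.

Let adj_ab : adj E a b. Proof. by case/andP: face_abc. Qed.
Let rot_ba : r b a = c. Proof. by case/andP: face_abc => _ /eqP. Qed.
Let rot_cb : r c b = a. Proof. by have [+ _] := tri_face triE adj_ab;
  rewrite rot_ba. Qed.
Let rot_ac : r a c = b. Proof. by have [_ +] := tri_face triE adj_ab;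
  rewrite rot_ba. Qed.
Let adj_bc : adj E b c. Proof. by rewrite -rot_ba (tri_rot triE) // adj_sym. Qed.
Let adj_ca : adj E c a. Proof. by rewrite -rot_cb (tri_rot triE) // adj_sym. Qed.
Let ab : a != b. Proof. exact: (tri_neq triE adj_ab). Qed.
Let bc : b != c. Proof. exact: (tri_neq triE adj_bc). Qed.
Let ca : c != a. Proof. exact: (tri_neq triE adj_ca). Qed.
Let ba : b != a. Proof. by rewrite eq_sym ab. Qed.
Let cb : c != b. Proof. by rewrite eq_sym bc. Qed.
Let ac : a != c. Proof. by rewrite eq_sym ca. Qed.
Let neqs := (negPf ab, negPf bc, negPf ca, negPf ba, negPf cb, negPf ac, eqxx).

Let inT x : x \in T -> [\/ x = a, x = b | x = c].
Proof. by rewrite !inE -orbA => /or3P[] /eqP;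
  [constructor 1 | constructor 2 | constructor 3]. Qed.

Let aT : a \in T. Proof. by rewrite !inE eqxx. Qed.

Let turnT x : x \in T -> turn x \in T.
Proof. by case/inT=> ->; rewrite /turn !neqs !inE eqxx ?orbT. Qed.

Let turn3 x : x \in T -> turn (turn (turn x)) = x.
Proof. by case/inT=> ->; rewrite /turn; do !rewrite !neqs /=. Qed.

Let adj_turn x : x \in T -> adj E x (turn x).
Proof. by case/inT=> ->; rewrite /turn; do !rewrite !neqs /=. Qed.

Let rot_turn x : x \in T -> r (turn x) x = turn (turn x).
Proof. by case/inT=> ->; rewrite /turn; do !rewrite !neqs /=. Qed.

Let TU x : x \in T -> x \in U.
Proof. by move/adj_turn/(tri_adjU triE)/andP => []. Qed.

Let neq_v x : x \in U -> (x == v) = false.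
Proof. by move=> xU; apply: contraNF vU => /eqP <-. Qed.

Let nadj_v x : ~~ adj E x v.
Proof. by apply/negP=> /(tri_adjU triE); rewrite (negPf vU) andbF. Qed.

(** Because [v] is a fixed point, composing [r x] with [tperm v (turn x)] splices [v] into the cycle
    through [turn x]. *)
Let rot_v x : r x v = v.
Proof. exact: (tri_fix triE (nadj_v x)). Qed.

Let rot'_hub x : x \in T -> r' x v = turn x.
Proof. by move=> xT; rewrite ffunE neq_v ?TU // xT permM rot_v tpermL. Qed.

Let rot'_in x : x \in T -> r' (turn x) x = v.
Proof.
move=> xT; rewrite ffunE neq_v ?TU ?turnT // permM rot_turn //; exact: tpermR.
Qed.

(** Around [v] the corners come in the order opposite to [turn], which closes the three new
    faces. *)
Let rot'_new x : x \in T -> r' v (turn x) = x.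
Proof.
rewrite ffunE eqxx permM /turn => /inT[] ->; rewrite !neqs ?tpermL ?tpermR //.
- by rewrite tpermD ?neqs.
- by rewrite (@tpermD _ a b c) ?neqs ?tpermR.
Qed.

Let rot'_old x y : x != v -> y != v -> ~~ ((y \in T) && (x == turn y)) -> r' x y =
  r x y.
Proof.
move=> xv yv nface; rewrite ffunE (negPf xv); case: ifP => // xT.
rewrite permM tpermD // eq_sym.
  by apply: contraNneq yv => rxy; rewrite -(inj_eq (@perm_inj _ (r x))) rot_v rxy.
apply: contra nface => /eqP rxy.
have zT := turnT (turnT xT); have xz := turn3 xT.
have rz := rot_turn zT; rewrite xz in rz.
by have -> : y = turn (turn x); [apply: (@perm_inj _ (r x));
  rewrite rxy | rewrite zT xz eqxx].
Qed.

Let rot'_away x : x != v -> x \notin T -> r' x = r x.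
Proof. by move=> xv xT; rewrite ffunE (negPf xv) (negPf xT). Qed.

Let rot'_v_fix y : y \notin T -> r' v y = y.
Proof.
rewrite ffunE eqxx permM !inE !negb_or -andbA => /and3P[ya yb yc].
by rewrite !tpermD // eq_sym.
Qed.

Let adj'_sym : symmetric (adj E') := @adj_sym V E'.

Let adj'_v y : adj E' v y = (y \in T).
Proof.
rewrite /adj inE; have := nadj_v y; rewrite adj_sym /adj => /negPf -> /=.
apply/imsetP/idP=> [[x xT /eq_set2[[_ ->]|[vx _]]] //|yT]; last by exists y.
by have := TU xT; rewrite -vx (negPf vU).
Qed.

Let adj'_old x y : x != v -> y != v -> adj E' x y = adj E x y.
Proof.
move=> xv yv; rewrite /adj inE; apply/orP/idP=> [[//|/imsetP[z _]]|]; last by left.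
by case/eq_set2=> -[vE zE]; rewrite vE zE eqxx in xv yv.
Qed.

Let adj_adj' x y : adj E x y -> adj E' x y.
Proof. by rewrite /adj inE => ->. Qed.

Let adj_nv x y : adj E x y -> (x != v) * (y != v).
Proof. by move=> /(tri_adjU triE)/andP[xU yU]; rewrite !neq_v. Qed.

Let stack_face x y : adj E' x y -> r' (r' y x) y = x /\ r' x (r' y x) = y.
Proof.
have [->|xv] := eqVneq x v.
  by rewrite adj'_v => yT; rewrite rot'_hub // rot'_in // rot'_new.
have [->|yv] := eqVneq y v.
  rewrite adj'_sym adj'_v => xT; have wT := turnT (turnT xT).
  have -> : r' v x = turn (turn x) by rewrite -{1}(turn3 xT) rot'_new.
  by rewrite rot'_hub // turn3 //; split=> //; rewrite -{1}(turn3 xT) rot'_in.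
rewrite adj'_old // => xy.
(* A dart of the stacked face now bounds a new face. Any other old dart keeps its face, since no
   dart of that face belongs to the stacked one. *)
have [/andP[xT /eqP yE]|nface] := boolP ((x \in T) && (y == turn x)).
  by rewrite yE rot'_in // rot'_new // rot'_hub.
have [rz rx] := tri_face triE xy.
have yz : adj E y (r y x) by rewrite (tri_rot triE) // adj_sym.
have zv := (adj_nv yz).2.
rewrite (rot'_old yv xv nface); split; rewrite rot'_old //.
  apply: contra nface => /andP[yT /eqP zE].
  move: rz; rewrite zE rot_turn // => <-.
  by rewrite !turnT // turn3 //= eqxx.
apply: contra nface => /andP[zT /eqP xE].
move: rx; rewrite {1}xE rot_turn // => <-.
by rewrite {1}xE turnT // [in turn x]xE eqxx.
Qed.

Let stack_fix x y : ~~ adj E' x y -> r' x y = y.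
Proof.
have [->|xv] := eqVneq x v; first by rewrite adj'_v => /rot'_v_fix.
have [->|yv] := eqVneq y v.
  by rewrite adj'_sym adj'_v => xT; rewrite rot'_away.
rewrite adj'_old // => nxy; rewrite rot'_old ?(tri_fix triE) //.
by apply: contra nxy => /andP[yT /eqP->]; rewrite adj_sym adj_turn.
Qed.

(** Where [v] has been inserted between [y] and [r x y], the old successor is reached in two steps,
    otherwise in one. *)
Let orbit_step x y : adj E x y -> r x y \in porbit (r' x) y.
Proof.
move=> xy; have [xv yv] := adj_nv xy.
have [/andP[yT /eqP xE]|nface] := boolP ((y \in T) && (x == turn y)).
  have := mem_porbit (r' x) 2 y.
  by rewrite expgS permM expg1 xE rot'_in // rot'_hub ?turnT // rot_turn.
by have := mem_porbit (r' x) 1 y; rewrite expg1 rot'_old.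
Qed.

Let orbit_old x y z : adj E x y -> adj E x z -> z \in porbit (r' x) y.
Proof.
move=> xy xz; have /porbitP[i ->] := tri_orbit triE xy xz.
have : adj E x ((r x ^+ i)%g y) /\ (r x ^+ i)%g y \in porbit (r' x) y.
  elim: i => [|i [IH1 IH2]]; first by rewrite expg0 perm1 porbit_id.
  rewrite expgSr permM; split; first exact: (tri_rot triE _).
  by move: IH2; rewrite -eq_porbit_mem => /eqP <-; apply: orbit_step.
by case.
Qed.

Let orbit_v x y : x \in T -> adj E x y -> v \in porbit (r' x) y.
Proof.
move=> xT xy; set w := turn (turn x).
have wT : w \in T by rewrite !turnT.
have xw : adj E x w by rewrite adj_sym -[x](turn3 xT) adj_turn.
have := orbit_old xy xw; rewrite -eq_porbit_mem => /eqP <-.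
have := mem_porbit (r' x) 1 w; rewrite expg1.
by rewrite -{1}(turn3 xT) rot'_in.
Qed.

Let stack_orbit x y z : adj E' x y -> adj E' x z -> z \in porbit (r' x) y.
Proof.
have [->|xv] := eqVneq x v.
  rewrite !adj'_v => yT zT.
  have p1 := mem_porbit (r' v) 1 y; have p2 := mem_porbit (r' v) 2 y.
  rewrite expg1 in p1; rewrite expgS permM expg1 in p2.
  have y1 : r' v y = turn (turn y) by rewrite -{1}(turn3 yT) rot'_new // !turnT.
  have y2 : r' v (turn (turn y)) = turn y by rewrite rot'_new // turnT.
  rewrite y1 y2 in p2; rewrite y1 in p1; have p0 := porbit_id (r' v) y.
  move: p0 p1 p2; rewrite /turn; case/inT: yT => ->; case/inT: zT => ->;
    by do !rewrite !neqs /=.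
have vcase y0 : x \in T -> adj E x y0 -> y0 \in porbit (r' x) v.
  by move=> xT xy; rewrite porbit_sym orbit_v.
have [->|yv] := eqVneq y v; have [->|zv] := eqVneq z v.
- by rewrite porbit_id.
- by rewrite adj'_sym adj'_v adj'_old // => xT; apply: vcase.
- by rewrite adj'_old // adj'_sym adj'_v => xy xT; apply: orbit_v.
- by rewrite !adj'_old //; apply: orbit_old.
Qed.

Lemma stack_triangulates : triangulates (v |: U) E' r'.
Proof.
split.
- apply/forall_inP=> e /setUP[/(forall_inP (tri_simple triE)) //|].
  by case/imsetP=> x /TU xU ->; rewrite cards2 [v == x]eq_sym neq_v.
- move=> e /setUP[/(tri_cover triE) eU|/imsetP[x /TU xU ->]].
    exact: subset_trans eU (subsetUr _ _).
  by rewrite subUset !sub1set !inE eqxx xU orbT.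
- have toa x : x \in v |: U -> connect (adj E') a x.
    case/setU1P=> [->|xU]; first by apply: connect1; rewrite adj'_sym adj'_v.
    have := tri_connect triE (TU aT) xU; apply: connect_sub => y z /adj_adj'.
    exact: connect1.
  move=> x y /toa ax /toa ay; apply: connect_trans ay.
  by rewrite adj_connect_sym.
- exact: stack_fix.
- exact: stack_orbit.
- exact: stack_face.
rewrite cardsU1 vU cardsU disjoint_setI0 ?cards0 ?subn0; last first.
  rewrite -setI_eq0; apply/eqP/setP=> e; rewrite !inE;
    apply/negP=> /andP[eE /imsetP[x _ ee]].
  by have := tri_cover triE eE; rewrite ee subUset sub1set (negPf vU).
rewrite card_in_imset; last first.
  move=> x y xT yT /eq_set2[[]//|[vy xv]].
  by have := vU; rewrite vy TU.
have -> : #|T| = 3 by rewrite /T setUC cardsU1 cards2 !inE !neqs.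
have := tri_card triE; card_lia.
Qed.

Lemma stack_facial_new :
  [/\ facial E' r' a b v, facial E' r' b c v & facial E' r' c a v].
Proof.
have F x : x \in T -> facial E' r' x (turn x) v.
  by move=> xT; rewrite /facial adj_adj' ?adj_turn // rot'_in // eqxx.
have bT : b \in T by rewrite !inE eqxx orbT.
have cT : c \in T by rewrite !inE eqxx orbT.
by have := (F a aT, F b bT, F c cT); rewrite /turn; do !rewrite !neqs /=;
  case=> -[].
Qed.

(** The excluded darts are the three of the face that [v] subdivides. *)
Lemma stack_facial_old x y z : facial E r x y z ->
  (x, y) \notin [:: (a, b); (b, c); (c, a)] -> facial E' r' x y z.
Proof.
case/andP=> xy /eqP <- nabc; have [xv yv] := adj_nv xy.
rewrite /facial adj_adj' // rot'_old ?eqxx //.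
apply: contra nabc => /andP[xT /eqP->].
by case/inT: xT => ->; rewrite /turn; do !rewrite !neqs /=; rewrite !inE eqxx ?orbT.
Qed.

Lemma stack_edges_sub : E \subset E'.
Proof. exact: subsetUl. Qed.

End Stack.

(** * The initial triangle *)

Section Triangle.
Variables (V : finType) (a b c : V).
Hypothesis abc : uniq [:: a; b; c].

Let T := [set a; b; c].
Let E := [set e : {set V} | (e \subset T) && (#|e| == 2)].
Let r : {ffun V -> {perm V}} := [ffun x =>
  if x == a then tperm b c else if x == b then tperm a c
  else if x == c then tperm a b else 1%g].

Let neqs : ((a == b) = false) * ((b == c) = false) * ((a == c) = false) *
  ((b == a) = false) * ((c == b) = false) * ((c == a) = false).
Proof.
have := abc; rewrite /= !inE negb_or andbT => /andP[/andP[ab ac] bc].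
by rewrite ![_ == a]eq_sym [c == b]eq_sym (negPf ab) (negPf ac) (negPf bc).
Qed.

Let adjE x y : adj E x y = [&& x \in T, y \in T & x != y].
Proof.
by rewrite /adj inE subUset !sub1set cards2 -andbA; case: (x == y).
Qed.

Let inT x : x \in T -> [\/ x = a, x = b | x = c].
Proof. by rewrite !inE -orbA => /or3P[] /eqP;
  [constructor 1 | constructor 2 | constructor 3]. Qed.

Let r_third x y z : x \in T -> y \in T -> z \in T -> uniq [:: x; y; z] -> r x y = z.
Proof.
by move=> /inT[]-> /inT[]-> /inT[]->; rewrite /= !inE ?eqxx ?orbT ?andbF //= => _;
  rewrite ffunE !(neqs, eqxx) ?tpermL ?tpermR.
Qed.

Let third x y : adj E x y -> exists2 z, z \in T & uniq [:: x; y; z].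
Proof.
rewrite adjE => /and3P[/inT[]-> /inT[]->]; rewrite ?eqxx // => _;
  by [exists a; rewrite /= !inE !(neqs, eqxx) | exists b;
    rewrite /= !inE !(neqs, eqxx) ?orbT
     | exists c; rewrite /= !inE !(neqs, eqxx) ?orbT].
Qed.

(** Each rotation exchanges the two neighbours of its vertex, so the triangle bounds two faces, one
    for each orientation. *)
Lemma triangle_triangulates : exists E r, triangulates T E r /\
  facial E r a b c /\ facial E r a c b.
Proof.
have aT : a \in T by rewrite !inE eqxx.
have bT : b \in T by rewrite !inE eqxx orbT.
have cT : c \in T by rewrite !inE eqxx orbT.
exists E, r; split; last first.
  rewrite /facial !adjE aT bT cT !neqs (@r_third b a c) ?(@r_third c a b) ?eqxx //.
    by rewrite /= !inE !neqs.
  by rewrite /= !inE !neqs.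
split.
- by apply/forall_inP=> e; rewrite inE => /andP[].
- by move=> e; rewrite inE => /andP[].
- move=> x y xT yT; have [->|xy] := eqVneq x y; first exact: connect0.
  by apply: connect1; rewrite adjE xT yT.
- move=> x y; rewrite adjE ffunE; have [xT|] := boolP (x \in T); last first.
    by rewrite !inE !negb_or -andbA => /and3P[/negPf-> /negPf-> /negPf->] _;
      rewrite perm1.
  rewrite /= negb_and negbK => yx; case/orP: yx => [yT|/eqP <-].
    move: yT; rewrite !inE !negb_or -andbA => /and3P[ya yb yc].
    by case/inT: xT => ->; rewrite !(neqs, eqxx) tpermD // eq_sym.
  by case/inT: xT => ->; rewrite !(neqs, eqxx) tpermD // !(neqs, eqxx).
- move=> x y z xy xz; have [<-|yz] := eqVneq y z; first exact: porbit_id.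
  have := mem_porbit (r x) 1 y; rewrite expg1 (@r_third x y z) //.
  + by move: xy; rewrite adjE => /and3P[].
  + by move: xy; rewrite adjE => /and3P[].
  + by move: xz; rewrite adjE => /and3P[].
  move: xy xz; rewrite !adjE /= !inE yz andbT => /and3P[_ _ xy] /and3P[_ _ xz].
  by rewrite negb_or xy xz.
- move=> x y xy; have [z zT] := third xy; rewrite /= !inE negb_or andbT.
  case/andP=> /andP[ne xz] yz; move: (xy); rewrite adjE => /and3P[xT yT _].
  have [yx zx zy] : [/\ y != x, z != x & z != y]
    by rewrite ![_ == x]eq_sym [z == y]eq_sym.
  rewrite (@r_third y x z) ?(@r_third z y x) ?(@r_third x z y) //=;
    by rewrite !inE negb_or andbT ?ne ?xz ?yz ?yx ?zx ?zy.
rewrite cards_draws; have -> : #|T| = 3; last by [].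
by rewrite /T setUC cardsU1 cards2 !inE !neqs.
Qed.
End Triangle.

Lemma facial_adj (V : finType) (U : {set V}) E r a b c :
  triangulates U E r -> facial E r a b c ->
  [/\ adj E a b, adj E b c & adj E c a].
Proof.
move=> triE /andP[ab /eqP<-]; have [rz _] := tri_face triE ab.
have yz : adj E b (r b a) by rewrite (tri_rot triE) // adj_sym.
by split=> //; rewrite -[X in adj E _ X]rz (tri_rot triE) // adj_sym.
Qed.

Lemma facial_neq (V : finType) (U : {set V}) E r a b c :
  triangulates U E r -> facial E r a b c -> [/\ a != b, b != c & c != a].
Proof.
by move=> triE /(facial_adj triE)[]; do 3!move=> /(tri_neq triE) ->.
Qed.

(* S is the set of hubs, M a matching, and q bounds the number of edges that
   avoid S. *)
Record config (V : finType) (U : {set V}) (E : {set {set V}})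
    (r : {ffun V -> {perm V}}) (S : {set V}) (M : {set {set V}}) (q : nat) :
    Prop := Config {
  cfg_tri : triangulates U E r;
  cfg_hub : S \subset U;
  cfg_sub : M \subset E;
  cfg_triv : trivIset M;
  cfg_free : #|[set e in E | [disjoint e & S]]| <= q
}.

(** * Extending a configuration by a matching edge or a vertex *)

Section Config.
Variables (V : finType) (U : {set V}) (E : {set {set V}}).
Variables (r : {ffun V -> {perm V}}) (S : {set V}) (M : {set {set V}}) (q : nat).
Hypothesis cfg : config U E r S M q.

Lemma cfg_coverU : cover M \subset U.
Proof.
apply/bigcupsP=> e /(subsetP (cfg_sub cfg)); exact: (tri_cover (cfg_tri cfg)).
Qed.

Lemma cfg_fresh v : v \notin U -> v \notin S /\ v \notin cover M.
Proof.
move=> vU; split; apply: contra vU; apply/subsetP; last exact: cfg_coverU.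
exact: cfg_hub cfg.
Qed.

Lemma config_match x y : adj E x y -> x \notin cover M -> y \notin cover M ->
  [/\ config U E r S ([set x; y] |: M) q, #|[set x; y] |: M| = #|M|.+1
    & cover ([set x; y] |: M) = [set x; y] :|: cover M].
Proof.
move=> xy xM yM; have M0 : set0 \notin M.
  apply/negP=> /(subsetP (cfg_sub cfg)) /(forall_inP (tri_simple (cfg_tri cfg))).
  by rewrite cards0.
have [tM _ cM sM] := trivIset_add_edge (cfg_triv cfg) M0 xM yM.
split=> //; split=> //; try by case: cfg.
by rewrite subUset sub1set (cfg_sub cfg) andbT.
Qed.

(** A hub brings no edge that avoids the hubs; a non-hub brings at most one for each corner outside
    [S]. The last clause keeps track of faces reserved for later insertions. *)
Lemma config_grow (hub : bool) a b c : facial E r a b c -> #|U| < #|V| ->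
  exists v E' r', [/\ v \notin U,
    config (v |: U) E' r' (if hub then v |: S else S) M
      (q + (if hub then 0 else (a \notin S) + (b \notin S) + (c \notin S))),
    [/\ facial E' r' a b v, facial E' r' b c v & facial E' r' c a v]
  & forall x y z, facial E r x y z ->
      (x, y) \notin [:: (a, b); (b, c); (c, a)] -> facial E' r' x y z].
Proof.
move=> abc UV; have [v vU] : exists v, v \notin U.
  apply/existsP; rewrite -negb_forall; apply: contraTN UV => /forallP UT.
  by rewrite -leqNgt subset_leq_card //; apply/subsetP.
exists v, (stack_edges E v a b c), (stack_rotation r v a b c).
have triE := cfg_tri cfg; split=> //; last exact: (stack_facial_old triE vU abc).
  split.
  - exact: (stack_triangulates triE vU abc).
  - by case: hub; rewrite ?subsetU1 ?setUS ?(subset_trans (cfg_hub cfg)) ?subsetU1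
      ?(cfg_hub cfg).
  - exact: subset_trans (cfg_sub cfg) (stack_edges_sub _ _ _ _ _).
  - exact: cfg_triv cfg.
  pose T := [set a; b; c].
  have leT : #|T :\: S| <= (a \notin S) + (b \notin S) + (c \notin S).
    have le1 x : #|[set x] :\: S| <= (x \notin S).
      have [xS|xS] /= := boolP (x \in S).
        by rewrite leqn0 cards_eq0 setD_eq0 sub1set.
      by rewrite (leq_trans (subset_leq_card (subsetDl _ _))) // cards1.
    rewrite !setDUl (leq_trans (leq_card_setU _ _)) // leq_add ?le1 //.
    by rewrite (leq_trans (leq_card_setU _ _)) // leq_add ?le1.
  apply: leq_trans (leq_add (cfg_free cfg) (_ : #|[set [set v;
    x] | x in T :\: (if hub then T else S)]| <= _)); last first.
    by case: hub; [rewrite setDv imset0 cards0 | apply: leq_trans (leq_imset_card _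
      _) leT].
  apply: leq_trans (leq_card_setU _ _); apply/subset_leq_card/subsetP=> e.
  rewrite !inE => /andP[/orP[eE|/imsetP[x xT ->]] dis].
    rewrite eE; apply/orP; left; apply: disjointWr dis.
    by case: (hub) => //; apply: subsetUr.
  apply/orP; right; apply/imsetP; exists x => //; rewrite in_setD xT andbT.
  move: dis; case: (hub); rewrite disjoint_subset => /subsetP dis.
    by have := dis v; rewrite !inE eqxx => /(_ isT).
  by have := dis x; rewrite !inE eqxx orbT => /(_ isT).
exact: (stack_facial_new triE vU abc).
Qed.

End Config.

(** * Building the extremal triangulation *)

Section LowerBound.
Variable V : finType.

(** The start is a triangle of hubs. A non-hub goes into the face [(a, c, b)] and is matched with
    [b], so [(a, b, c)] remains a face of hubs. *)
Lemma config_base : 4 <= #|V| ->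
  exists (U : {set V}) E r S M a b c,
  [/\ config U E r S M 0, [/\ #|U| = 4, #|S| = 3 & #|M| = 1],
      [/\ a \in S, b \in S & c \in S]
    & [/\ facial E r a b c, a \notin cover M & c \notin cover M]].
Proof.
move=> V4; have /card_gt2P[a [b [c [_ [ab bc ca]]]]] : 2 < #|[set: V]|.
  by rewrite cardsT; apply: ltnW.
have abc : uniq [:: a; b; c] by rewrite /= !inE negb_or ab bc [a == c]eq_sym ca.
have [E [r [triE [Fabc Facb]]]] := triangle_triangulates abc.
set T := [set a; b; c] in triE.
have T3 : #|T| = 3 by rewrite /T setUC cardsU1 cards2 !inE negb_or ca eq_sym bc ab.
have [aT bT cT] : [/\ a \in T, b \in T & c \in T] by rewrite !inE !eqxx !orbT.
have cfg0 : config T E r T set0 0.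
  split=> //; first exact: sub0set.
    by apply/trivIsetP=> A B; rewrite inE.
  rewrite leqn0 cards_eq0; apply/eqP/setP=> e; rewrite !inE; apply/negP=> /andP[eE].
  have := tri_cover triE eE; move/(forall_inP (tri_simple triE)): eE => e2 eT.
  rewrite -setI_eq0 (setIidPl eT) => /eqP e0; by rewrite e0 cards0 in e2.
have [|v [E' [r' [vT cfg1 [_ Fcbv _] old]]]] := config_grow cfg0 false Facb.
  by rewrite T3.
rewrite aT bT cT /= in cfg1.
have [_ bv _] := facial_adj (cfg_tri cfg1) Fcbv.
have cov0 (x : V) : x \notin cover set0 by rewrite /cover big_set0 inE.
have [cfg2 M1 cM] := config_match cfg1 bv (cov0 b) (cov0 v).
have vN x : x \in T -> (x == v) = false by move=> xT; apply: contraNF vT => /eqP <-.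
exists (v |: T), E', r', T, ([set b; v] |: set0), a, b, c; split=> //.
- by rewrite M1 cards0 cardsU1 vT T3.
- rewrite cM !in_setU (negPf (cov0 a)) (negPf (cov0 c)) !inE !vN //.
  rewrite (negPf ab) [c == b]eq_sym (negPf bc); split=> //.
  by apply: old; rewrite // !inE !xpair_eqE (negPf ab) (negPf bc) [a == c]eq_sym
    (negPf ca) andbF.
Qed.

(** The new hub [v] splits the face into three: a non-hub [p] in [(b, c, v)] is matched with [v], a
    non-hub [w] in [(c, a, v)] stays unmatched, and [(a, b, v)] is again a face of hubs. *)
Lemma config_hub (U : {set V}) E r S M q a b c :
  config U E r S M q -> facial E r a b c -> [/\ a \in S, b \in S & c \in S] ->
  #|U| + 3 <= #|V| ->
  exists (U' : {set V}) E' r' M' v w,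
  [/\ config U' E' r' (v |: S) M' q,
     [/\ #|U'| = #|U| + 3, #|v |: S| = #|S|.+1 & #|M'| = #|M|.+1],
     facial E' r' a b v
   & [/\ w \notin cover M', adj E' w c, w != a & {in U, cover M' =i cover M}]].
Proof.
move=> cfg abc [aS bS cS] UV; have SU := subsetP (cfg_hub cfg).
have [ab bc ca] := facial_neq (cfg_tri cfg) abc.
have [|v [E1 [r1 [vU cfg1 [abv bcv cav] _]]]] := config_grow cfg true abc;
  first by card_lia.
have vN x : x \in S -> (x == v) = false by move=> /SU xU;
  apply: contraNF vU => /eqP <-.
have Nv x : x \in S -> (v == x) = false by rewrite eq_sym; apply: vN.
have [vS vM] := cfg_fresh cfg vU.
have U1 : #|v |: U| = #|U|.+1 by rewrite cardsU1 vU.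
have [|p [E2 [r2 [pU cfg2 [_ cvp _] old2]]]] := config_grow cfg1 false bcv;
  first by card_lia.
have abv2 : facial E2 r2 a b v.
  by apply: old2; rewrite // !inE !xpair_eqE (negPf ab) !vN ?andbF.
have cav2 : facial E2 r2 c a v.
  by apply: old2; rewrite // !inE !xpair_eqE !vN // [c == b]eq_sym (negPf bc)
    ?andbF.
rewrite !in_setU bS cS set11 !orbT /= !addn0 in cfg2.
have U2 : #|p |: (v |: U)| = #|U| + 2 by rewrite cardsU1 pU U1; card_lia.
have [_ vp _] := facial_adj (cfg_tri cfg2) cvp.
have pM : p \notin cover M by apply: (cfg_fresh cfg1 pU).2.
have [cfg2' M2 cM2] := config_match cfg2 vp vM pM.
have [|w [E3 [r3 [wU cfg3 [caw _ _] old3]]]] := config_grow cfg2' false cav2;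
  first by card_lia.
rewrite !in_setU aS cS set11 !orbT /= !addn0 in cfg3.
have [_ _ wc] := facial_adj (cfg_tri cfg3) caw.
exists (w |: (p |: (v |: U))), E3, r3, ([set v; p] |: M), v, w; split=> //.
- by rewrite cardsU1 wU U2 cardsU1 vS M2; split; card_lia.
- by apply: old3; rewrite // !inE !xpair_eqE !vN // [a == c]eq_sym (negPf ca)
    ?andbF.
split=> //.
- exact: (cfg_fresh cfg2' wU).2.
- by apply: contraNneq wU => ->; rewrite !in_setU SU ?orbT.
move=> x xU; rewrite cM2 !inE; case: eqP => [xv|_]; first by rewrite -xv xU in vU.
by case: eqP => [xp|_] //; rewrite -xp !inE xU orbT in pU.
Qed.

(** Each round works in a face of hubs at [a] and adds three vertices, one hub and one matching
    edge; [a] stays unmatched for the final stage. *)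
Lemma config_hubs k : 3 * k + 7 <= #|V| ->
  exists (U : {set V}) E r S M a b c,
  [/\ config U E r S M 0, [/\ #|U| = 3 * k + 7, #|S| = k + 4 & #|M| = k + 3],
      [/\ a \in S, b \in S & c \in S] & facial E r a b c /\ a \notin cover M].
Proof.
elim: k => [|k IH] kV.
  have [|U [E [r [S [M [a [b [c [cfg [U4 S3 M1] [aS bS cS] [abc aM cM]]]]]]]]]]
    := config_base.
    by card_lia.
  have [|U' [E' [r' [M' [v [w [cfg' [U'c S'c M'c] abv [wM wc wa cov]]]]]]]]
    := config_hub cfg abc (And3 aS bS cS).
    by card_lia.
  have SU := subsetP (cfg_hub cfg).
  have cM' : c \notin cover M' by rewrite cov ?SU.
  (* Only in the first round is [w] matched: it covers [c], the last hub besides [a] without a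
     partner. *)
  have [cfg2 cM2 covM2] := config_match cfg' wc wM cM'.
  exists U', E', r', (v |: S), ([set w; c] |: M'), a, b, v; split=> //.
  - by rewrite cM2 M'c M1 S'c S3 U'c U4.
  - by rewrite !inE aS bS eqxx !orbT.
  split=> //; rewrite covM2 !inE negb_or cov ?SU // aM andbT negb_or eq_sym wa.
  by have [_ _] := facial_neq (cfg_tri cfg) abc; rewrite eq_sym.
have [|U [E [r [S [M [a [b [c [cfg [U4 S3 M1] [aS bS cS] [abc aM]]]]]]]]]] := IH;
  first by card_lia.
have [|U' [E' [r' [M' [v [w [cfg' [U'c S'c M'c] abv [wM wc wa cov]]]]]]]]
  := config_hub cfg abc (And3 aS bS cS).
  by card_lia.
exists U', E', r', (v |: S), M', a, b, v; split=> //.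
- by split; card_lia.
- by rewrite !inE aS bS eqxx !orbT.
by split=> //; rewrite cov // (subsetP (cfg_hub cfg)).
Qed.

(** Two non-hubs [v] and [w], stacked in turn along the side [xy], form a matching edge. The price
    is two edges that avoid [S], namely [vz] and [vw]. *)
Lemma config_pair (U : {set V}) E r S M q x y z :
  config U E r S M q -> facial E r x y z -> x \in S -> y \in S -> z \notin S ->
  #|U| + 2 <= #|V| ->
  exists (U' : {set V}) E' r' M' w,
  [/\ config U' E' r' S M' (q + 2), #|U'| = #|U| + 2 /\ #|M'| = #|M|.+1,
     facial E' r' x y w /\ w \notin S
   & forall x' y' z', x' \in S -> y' \in S -> (x', y') != (x, y) ->
       facial E r x' y' z' -> facial E' r' x' y' z'].
Proof.
move=> cfg xyz xS yS zS UV.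
have [|v [E1 [r1 [vU cfg1 [xyv _ _] old1]]]] := config_grow cfg false xyz;
  first by card_lia.
have [vS vM] := cfg_fresh cfg vU.
have U1 : #|v |: U| = #|U|.+1 by rewrite cardsU1 vU.
have [|w [E2 [r2 [wU cfg2 [xyw yvw _] old2]]]] := config_grow cfg1 false xyv;
  first by card_lia.
have [wS wM] := cfg_fresh cfg1 wU.
rewrite xS yS zS vS /= in cfg2.
have [_ vw _] := facial_adj (cfg_tri cfg2) yvw.
have [cfg3 cM _] := config_match cfg2 vw vM wM.
have neS a b : a \in S -> b \notin S -> (a == b) = false.
  by move=> aS bS; apply: contraNF bS => /eqP <-.
exists (w |: (v |: U)), E2, r2, ([set v; w] |: M), w; split=> //.
- by move: cfg3; rewrite -addnA.
- by rewrite cardsU1 wU U1 cM; card_lia.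
move=> x' y' z' x'S y'S ne F.
apply: old2; first apply: old1 => //;
  rewrite !inE (negPf ne) !xpair_eqE !(neS _ _ _ zS, neS _ _ _ vS) // andbF //.
Qed.

Lemma config_large t k : 6 <= t -> 3 * t - 6 <= k -> k <= #|V| ->
  exists (U : {set V}) E r S M x y z,
  [/\ config U E r S M (k - (3 * t - 10)),
      [/\ #|U| = k, #|S| = t - 2 & #|M| = t],
      [/\ x \in S, y \in S & z \notin S] & facial E r x y z].
Proof.
move=> t6; elim: k => [|k IH] kt kV; first by card_lia.
(* Beyond [3 * t - 6] vertices, each further one goes into a face with two hubs and costs one edge
   away from [S]. *)
have [kt'|] := leqP (3 * t - 6) k.
  have [|U [E [r [S [M [x [y [z [cfg [Uk St Mt] [xS yS zS] xyz]]]]]]]]] := IH kt'.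
    by card_lia.
  have [|v [E1 [r1 [vU cfg1 [xyv _ _] _]]]] := config_grow cfg false xyz;
    first by card_lia.
  have [vS _] := cfg_fresh cfg vU.
  rewrite xS yS zS /= in cfg1.
  exists (v |: U), E1, r1, S, M, x, y, v; split=> //.
    by move: cfg1; have -> : k - (3 * t - 10) + (0 + 0 + 1) = k.+1 - (3 * t - 10)
      by card_lia.
  by rewrite cardsU1 vU; split; card_lia.
move=> kt'; have {kt kt' IH} k1 : k.+1 = 3 * t - 6 by card_lia.
(* After [config_hubs] there are [3 * t - 11] vertices and [t - 3] matching edges. The vertex [z]
   becomes the partner of [a]; one pair in each of [(a, b, z)] and [(b, c, z)] completes [t] edges,
   with four edges away from [S]. *)
have [|U [E [r [S [M [a [b [c [cfg [U1 S1 M1] [aS bS cS] [abc aM]]]]]]]]]]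
  := @config_hubs (t - 6).
  by card_lia.
have [ab bc ca] := facial_neq (cfg_tri cfg) abc.
have [|z [E1 [r1 [zU cfg1 [abz bcz caz] _]]]] := config_grow cfg false abc;
  first by card_lia.
have Uz : #|z |: U| = #|U|.+1 by rewrite cardsU1 zU.
rewrite aS bS cS /= in cfg1.
have [zS zM] := cfg_fresh cfg zU.
have [_ az _] := facial_adj (cfg_tri cfg1) caz.
have [cfg2 M2 _] := config_match cfg1 az aM zM.
have [|U3 [E3 [r3 [M3 [w [cfg3 [U3c M3c] [abw wS] old3]]]]]]
  := config_pair cfg2 abz aS bS zS.
  by card_lia.
have bcz3 : facial E3 r3 b c z.
  by apply: old3 => //; rewrite xpair_eqE eq_sym (negPf ab).
have [|U4 [E4 [r4 [M4 [w4 [cfg4 [U4c M4c] [_ _] old4]]]]]]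
  := config_pair cfg3 bcz3 bS cS zS.
  by card_lia.
exists U4, E4, r4, S, M4, a, b, w; split=> //.
- by move: cfg4; have -> : k.+1 - (3 * t - 10) = 4 by card_lia.
- by rewrite M4c M3c M2 M1; split; card_lia.
by apply: old4 => //; rewrite xpair_eqE (negPf ab).
Qed.
End LowerBound.

(** * Colouring the construction *)

Lemma matching_avoid (V : finType) t (phi : {ffun 'I_t * bool -> V}) (S : {set V}) :
  injective phi -> #|S| + 2 <= t ->
  exists e e', [/\ e \in matching t, e' \in matching t, e != e',
    [disjoint phi @: e & S] & [disjoint phi @: e' & S]].
Proof.
move=> phiI St; pose edge (i : 'I_t) := [set (i, false); (i, true)].
pose B := [set i : 'I_t | (phi (i, false) \in S) || (phi (i, true) \in S)].
(* For an edge that meets [S] this is an end in [S]. Since [f] is injective, at most [#|S|] edges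
   meet [S], and two others remain. *)
pose f i := phi (i, phi (i, false) \notin S).
have fI : injective f by move=> i j /phiI[].
have BS : #|B| <= #|S|.
  rewrite -(card_imset _ fI); apply/subset_leq_card/subsetP=> _ /imsetP[i + ->].
  by rewrite inE /f; case: (boolP (phi (i, false) \in S)).
have : 1 < #|~: B| by have := cardsC B; rewrite card_ord; card_lia.
have dis i : i \in ~: B -> [disjoint phi @: edge i & S].
  rewrite !inE negb_or => /andP[i0 i1]; rewrite imsetU1 imset_set1 disjoint_subset.
  by apply/subsetP=> x /set2P[] ->; rewrite inE.
case/card_gt1P=> i [j [iB jB ij]]; exists (edge i), (edge j); split;
  rewrite ?dis ?imset_f //.
apply: contra ij => /eqP/setP/(_ (i, false)); rewrite set21 => /esym.
by case/set2P=> -[->].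
Qed.

Lemma config_rainbow_free n t (E : {set {set 'I_n}}) r S M q :
  config [set: 'I_n] E r S M q -> 0 < n -> #|S| + 2 <= t -> t <= #|M| ->
  exists2 k, 3 * n - 5 <= k + q & rainbow_free_colors (matching t) n k.
Proof.
move=> cfg n0 St tM; have triE := cfg_tri cfg; have sE := tri_simple triE.
have sM : simple M by apply/forall_inP=> e /(subsetP (cfg_sub cfg));
  apply: (forall_inP sE).
have [phi [phiI phiM]] := matching_copy sM (cfg_triv cfg) tM.
pose N := [set e in E | ~~ [disjoint e & S]]; exists #|N|.+1.
  have := tri_card triE; have := cfg_free cfg; rewrite cardsT card_ord.
  suff : #|E| <= #|N| + #|[set e in E | [disjoint e & S]]| by card_lia.
  rewrite addnC -(cardsID [set e : {set 'I_n} | [disjoint e & S]] E) leq_add //.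
    by apply/subset_leq_card/subsetP=> e; rewrite !inE.
  by apply/subset_leq_card/subsetP=> e; rewrite !inE andbC.
apply/existsP; exists E; apply/and3P; split.
- by apply: (triangulates_plane triE); rewrite // card_ord.
- apply/existsP; exists phi; apply/andP; split; first exact/injectiveP.
  by apply/forall_inP=> e /phiM /(subsetP (cfg_sub cfg)).
(* The index of an edge outside [enum N] is the length [#|N|], so all edges that avoid [S] share the
   last colour. *)
pose c := [ffun e : {set 'I_n} => inord (index e (enum N)) : 'I_#|N|.+1].
have cN (e : {set 'I_n}) : [disjoint e & S] -> c e = ord_max.
  move=> dis; apply: val_inj; rewrite ffunE /= -[X in inord X]/(index e (enum N)).
  by rewrite memNindex ?inordK -?cardE // mem_enum inE dis andbF.
apply/existsP; exists c; apply/andP; split.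
  apply/eqP/setP=> j; rewrite inE; have [jN|jN] := ltnP j #|N|; last first.
    (* The last colour does occur: the matching itself has an edge that avoids [S]. *)
    have [e [_ [eM _ _ dis _]]] := matching_avoid phiI St.
    apply/imsetP; exists (phi @: e);
      first exact: (subsetP (cfg_sub cfg)) (phiM _ eM).
    by rewrite cN //; apply/val_inj/eqP; rewrite /= eqn_leq jN -ltnS ltn_ord.
  pose e := nth set0 (enum N) j.
  have jsz : j < size (enum N) by rewrite -cardE.
  have eN : e \in N by rewrite -mem_enum mem_nth.
  apply/imsetP; exists e; first by move: eN; rewrite inE => /andP[].
  by apply: val_inj; rewrite ffunE index_uniq ?enum_uniq //= inordK // ltnS ltnW.
apply/existsPn=> psi; apply/negP=> /andP[/andP[/injectiveP psiI _] /forall_inP rb].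
have [e [e' [eM e'M ee' dis dis']]] := matching_avoid psiI St.
by have := forall_inP (rb e eM) e' e'M; rewrite !cN // eqxx (negPf ee').
Qed.

Theorem theorem3 (t n : nat) (ht : 6 <= t) (hn : 3 * t - 6 <= n) :
  2 * n + 3 * t - 15 <= planar_ar (matching t) n /\
  planar_ar (matching t) n <= 2 * n + 4 * t - 14.
Proof.
split; last by apply/bigmax_leqP=> k; apply: rainbow_free_colors_le.
have [|U [E [r [S [M [x [y [z [cfg [Un St Mt] _ _]]]]]]]]]
  := @config_large 'I_n t n ht hn.
  by rewrite card_ord.
have UT : U = setT by apply/eqP; rewrite eqEcard subsetT cardsT card_ord Un /=.
(* With [q = n - (3 * t - 10)], the inequality [3 * n - 5 <= k + q] becomes
   [2 * n + 3 * t - 15 <= k]. *)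
rewrite {}UT in cfg Un; have [|||k kq /planar_ar_max] := config_rainbow_free cfg (t
  := t); card_lia.
Qed.
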